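(* Let $K\in\mathbb R$, $N\in(1,\infty)$ and $D>0$, with $D\le\pi\sqrt{(N-1)/K}$ if $K>0$. For each $v\in(0,1)$, $$\widetilde{\mathcal I}_{K,N,D}(v)=f_{K,N,D}(a_{K,N,D}(v)).$$ In particular, since $f_{K,N,D}(a_{K,N,D}(v))=h_{a}(a)$ with $a=a_{K,N,D}(v)$, the lower bound is attained (i.e. the infimum defining $\widetilde{\mathcal I}_{K,N,D}(v)$ is attained).
   Context: Put $\kappa=K/(N-1)$ and $s_\kappa(\theta)=\frac{1}{\sqrt\kappa}\sin(\sqrt\kappa\,\theta)$ if $\kappa>0$, $s_0(\theta)=\theta$, $s_\kappa(\theta)=\frac1{\sqrt{-\kappa}}\sinh(\sqrt{-\kappa}\,\theta)$ if $\kappa<0$. For $t\in[0,1]$: $\sigma^{(t)}_{K,N-1}(0)=t$; $\sigma^{(t)}_{K,N-1}(\theta)=s_\kappa(t\theta)/s_\kappa(\theta)$ for $\theta>0$ (and $\theta<\pi/\sqrt\kappa$ if $\kappa>0$); $\sigma^{(t)}_{K,N-1}(\theta)=+\infty$ if $\kappa>0$ and $\theta\ge\pi/\sqrt\kappa$. A non-negative Borel function $h:[0,D]\to\mathbb R$ is an $\mathsf{MCP}(K,N)$-density if $h(tx_1+(1-t)x_0)\ge\sigma^{(1-t)}_{K,N-1}(|x_1-x_0|)^{N-1}h(x_0)$ for all $x_0,x_1\in[0,D]$, $t\in[0,1]$ (convention $\infty\cdot0=0$). Such densities are taken to be continuous up to the boundary of $[0,D]$. For a measure $\mu$ on $\mathbb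 R$, $\mu^+(A)=\liminf_{\varepsilon\to0^+}\frac{\mu(A^\varepsilon)-\mu(A)}{\varepsilon}$ with $A^\varepsilon=\{x:\mathrm{dist}(x,A)<\varepsilon\}$. Define $$\widetilde{\mathcal I}_{K,N,D}(v)=\inf\{\mu^+(A):A\subset[0,D]\text{ Borel},\ \mu(A)=v,\ \mu\in\widetilde{\mathcal F}_{K,N,D}\},$$ where $\widetilde{\mathcal F}_{K,N,D}$ is the set of probability measures $\mu=h_\mu\mathcal L^1$ with $h_\mu:[0,D]\to\mathbb R$ an $\mathsf{MCP}(K,N)$-density. For $a\in(0,D)$ put $$f_{K,N,D}(a)=\Big(\int_0^a\Big(\tfrac{s_\kappa(D-y)}{s_\kappa(D-a)}\Big)^{N-1}dy+\int_a^D\Big(\tfrac{s_\kappa(y)}{s_\kappa(a)}\Big)^{N-1}dy\Big)^{-1},$$ and let $h_a:[0,D]\to\mathbb R$ be $h_a(x)=f_{K,N,D}(a)\big(\tfrac{s_\kappa(D-x)}{s_\kappa(D-a)}\big)^{N-1}$ for $x\le a$, $h_a(x)=f_{K,N,D}(a)\big(\tfrac{s_\kappa(x)}{s_\kappa(a)}\big)^{N-1}$ for $x\ge a$. The map $a\mapsto\int_0^ah_a(x)\,dx$ is a bijection of $(0,D)$ onto $(0,1)$, and $a_{K,N,D}(v)$ denotes the unique $a\in(0,D)$ with $\int_0^ah_a(x)\,dx=v$. *)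

(* Defs.v *)
From HB Require Import structures.
From mathcomp Require Import all_boot all_order all_algebra.
From mathcomp Require Import all_classical all_reals all_analysis.

Set Implicit Arguments.
Unset Strict Implicit.
Unset Printing Implicit Defensive.

Import Order.TTheory GRing.Theory Num.Theory.
Import numFieldNormedType.Exports.

Local Open Scope classical_set_scope.
Local Open Scope ring_scope.

Definition kappa {R : realType} (K N : R) : R := K / (N - 1).

Definition sinh {R : realType} (x : R) : R := (expR x - expR (- x)) / 2.

Definition s_kappa {R : realType} (k theta : R) : R :=
  if 0 < k then sin (Num.sqrt k * theta) / Num.sqrt k
  else if k == 0 then theta
  else sinh (Num.sqrt (- k) * theta) / Num.sqrt (- k).

(* sigma K N t theta is sigma^{(t)}_{K,N-1}(theta); it is only meaningful (and
   only used) for 0 <= t <= 1 and 0 <= theta. *)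
Definition sigma {R : realType} (K N t theta : R) : \bar R :=
  if theta == 0 then t%:E
  else if (0 < kappa K N) && (pi / Num.sqrt (kappa K N) <= theta) then +oo%E
  else (s_kappa (kappa K N) (t * theta) / s_kappa (kappa K N) theta)%:E.

(* A function on [0, D] is represented by a function on R whose values outside
   [0, D] are never used.  The product of extended reals satisfies
   +oo * 0 = 0. *)
Definition MCP_density {R : realType} (K N D : R) (h : R -> R) : Prop :=
  [/\ forall x, x \in `[0, D] -> 0 <= h x,
      measurable_fun `[0, D] h,
      {within `[0, D], continuous h} &
      forall x0 x1 t : R,
        x0 \in `[0, D] -> x1 \in `[0, D] -> t \in `[0, 1] ->
        ((sigma K N (1 - t)%R `|x1 - x0|%R) `^ (N - 1)%R * (h x0)%:E
          <= (h (t * x1 + (1 - t) * x0)%R)%:E)%E].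

Definition Ftilde {R : realType} (K N D : R) :
    set (probability (measurableTypeR R) R) :=
  [set mu | exists2 h : R -> R, MCP_density K N D h &
     forall B : set (measurableTypeR R), measurable B ->
       mu B = (\int[lebesgue_measure]_(x in B `&` `[0%R, D]) (h x)%:E)%E].

Definition enlargement {R : realType} (A : set R) (eps : R) : set R :=
  [set x | (edist_inf A x < eps%:E)%E].

Definition muplus {R : realType}
    (mu : {measure set (measurableTypeR R) -> \bar R}) (A : set R) : \bar R :=
  limf_einf (fun eps : R => ((mu (enlargement A eps) - mu A) * eps^-1%:E)%E)
    0^'+.

Definition competitor {R : realType} (K N D v : R)
    (mu : probability (measurableTypeR R) R)
    (A : set (measurableTypeR R)) : Prop :=
  [/\ Ftilde K N D mu, measurable A, A `<=` `[0, D] & mu A = v%:E].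

Definition Itilde {R : realType} (K N D v : R) : \bar R :=
  ereal_inf [set m | exists mu A, competitor K N D v mu A /\ m = muplus mu A].

Definition fKND {R : realType} (K N D a : R) : R :=
  let s := s_kappa (kappa K N) in
  ((\int[lebesgue_measure]_(y in `[0, a]) ((s (D - y) / s (D - a)) `^ (N - 1)))
   + (\int[lebesgue_measure]_(y in `[a, D]) ((s y / s a) `^ (N - 1))))^-1.

Definition hKND {R : realType} (K N D a x : R) : R :=
  let s := s_kappa (kappa K N) in
  if x <= a then fKND K N D a * (s (D - x) / s (D - a)) `^ (N - 1)
  else fKND K N D a * (s x / s a) `^ (N - 1).

(* The point a of ]0, D[ with \int_0^a h_a = v.  For 0 < v < 1 it exists and is
   unique, because a |-> \int_0^a h_a is a bijection of ]0, D[ onto ]0, 1[;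
   hence neither the default value 0 nor the choice made by xget matters. *)
Definition aKND {R : realType} (K N D v : R) : R :=
  xget 0 [set a | 0 < a < D /\
                      (\int[lebesgue_measure]_(x in `[0, a]) hKND K N D a x) = v].

(* Main.v *)
Require Import Defs.
From HB Require Import structures.
From mathcomp Require Import all_boot all_order all_algebra.
From mathcomp Require Import all_classical all_reals all_analysis.
From mathcomp Require Import measurable_realfun ring lra.
Import Order.TTheory GRing.Theory Num.Theory.
Import numFieldNormedType.Exports.
Local Open Scope classical_set_scope.
Local Open Scope ring_scope.

Set Implicit Arguments.
Unset Strict Implicit.
Unset Printing Implicit Defensive.

(** The functions [s_kappa] satisfy Ptolemy's identity
      s(r-p) s(t-q) = s(q-p) s(t-r) + s(r-q) s(t-p)
    ([s_kappa_ptolemy]): the chords of four points on a circle, a line or a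
    hyperbola.  Since s >= 0 on [0, D], both terms on the right are at most the
    left-hand side, and this survives taking powers.  So the whole argument only
    uses phi = s ^ (N-1), through the two inequalities of [ptolemaic].

    Away from endpoints where the coefficient sigma is infinite, the MCP
    condition says that, for x0 <= x <= x1,
      h(x0) phi(x1-x) <= h(x) phi(x1-x0),  h(x1) phi(x-x0) <= h(x) phi(x1-x0).
    This form, [contracting], has no division and also encodes the infinite
    case (there phi(x1-x0) = 0, which forces h(x0) = h(x1) = 0).

    Taking x1 = D, or x0 = 0, bounds h on either side of a point b by h(b) times
    a comparison function, hence
      mu [0,b] <= cap(b) h(b)   and   mu [b,D] <= cap(D-b) h(b),
    where cap(b) is the integral over [0,b] of phi(D-x)/phi(D-b).  By Ptolemy,
    cap is nondecreasing ([cap_le]).  Now f(a) = 1/(cap(a) + cap(D-a)), and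
    a = a(v) is characterised by v = f(a) cap(a), 1-v = f(a) cap(D-a); it exists
    by the intermediate value theorem ([cap_balance]).

    For the lower bound ([muplus_ge_cap]) let C be the closure of A; one may
    assume mu C = v, as otherwise the content is infinite.  An end p of a gap of
    C contributes h(p) to the content, and at most two ends are needed.
    Let m <= m' be the two points a and D-a.
    - If C avoids [m,m'], or contains [m,m'], then C, or its complement, lies on
      the two sides of [m,m'].  The gap ends p, q next to [m,m'] satisfy
      mass <= M (h(p) + h(q)), with M = cap(a) or M = cap(D-a) respectively.
      When a <= D-a this settles the first case on [m,m'], and the second case
      on each of the one-point intervals at a and at D-a, because cap(a) is then
      the smaller of the two caps; when D-a <= a the roles are exchanged.
    - What remains is that two disjoint gaps, or the two ends of one gap, have
      ends p, q in [m,m'].  There both mu [0,b] and mu [b,D] are at most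
      max(cap(a), cap(D-a)) h(b) and they add up to 1, so h(b) >= f(a)/2 and
      h(p) + h(q) >= f(a).

    The bound is attained by A = [0,a] for h_a.  On [0,D] this density is f(a)
    times the maximum of phi(D-x)/phi(D-a) and phi(x)/phi(a) ([peak]); each of
    the two is [contracting] by Ptolemy, and so is their maximum. *)

Local Notation leb := (@lebesgue_measure _).

(** * The functions s_kappa *)

Lemma continuous_sinh (R : realType) : continuous (@sinh R).
Proof.
move=> x; apply: cvgMr_tmp => /=; apply: cvgB; first exact: continuous_expR.
apply: (@continuous_comp _ _ _ -%R (@expR R)); last exact: continuous_expR.
exact: continuousN.
Qed.

Lemma sinh_gt0 (R : realType) (x : R) : 0 < x -> 0 < sinh x.
Proof.
by move=> x0; rewrite divr_gt0// subr_gt0 ltr_expR; lra.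
Qed.

Lemma s_kappa_continuous (R : realType) (k : R) : continuous (s_kappa k).
Proof.
have lin c : continuous (fun x : R => c * x).
  by move=> x; apply: cvgMl_tmp; apply: cvg_id.
move=> x; rewrite /s_kappa; case: (0 < k); last case: (k == 0).
- apply: cvgMr_tmp => /=; apply: (@continuous_comp _ _ _ _ (@sin R)).
    exact: lin.
  exact: continuous_sin.
- exact: cvg_id.
- apply: cvgMr_tmp => /=; apply: (@continuous_comp _ _ _ _ (@sinh R)).
    exact: lin.
  exact: continuous_sinh.
Qed.

Lemma s_kappa0 (R : realType) (k : R) : s_kappa k 0 = 0.
Proof.
rewrite /s_kappa; case: ifPn => _; first by rewrite mulr0 sin0 mul0r.
case: ifPn => _ //; by rewrite mulr0 /sinh oppr0 subrr !mul0r.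
Qed.

Lemma s_kappa_gt0 (R : realType) (k x : R) :
  0 < x -> (0 < k -> x < pi / Num.sqrt k) -> 0 < s_kappa k x.
Proof.
move=> x0 xk; rewrite /s_kappa; case: ifPn => k0; last case: ifPn => // kn0.
- have sk : 0 < Num.sqrt k by rewrite sqrtr_gt0.
  rewrite divr_gt0// sin_gt0_pi// mulr_gt0//=.
  by rewrite mulrC -ltr_pdivlMr// xk.
- have sk : 0 < Num.sqrt (- k).
    by rewrite sqrtr_gt0 oppr_gt0 lt_neqAle kn0 leNgt.
  by rewrite divr_gt0// sinh_gt0// mulr_gt0.
Qed.

(** When D is maximal this makes the profile vanish at D, which is how the
    infinite values of sigma are seen by the division-free form of the
    condition. *)
Lemma s_kappa_diameter (R : realType) (k : R) :
  0 < k -> s_kappa k (pi / Num.sqrt k) = 0.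
Proof.
move=> k0; rewrite /s_kappa k0 mulrCA divff ?mulr1 ?sinpi ?mul0r//.
by rewrite gt_eqF// sqrtr_gt0.
Qed.

(** Ptolemy's theorem for four points p, q, r, t in this order: the product of
    the diagonals is the sum of the products of opposite sides. *)
Lemma s_kappa_ptolemy (R : realType) (k p q r t : R) :
  let s := s_kappa k in
  s (r - p) * s (t - q) = s (q - p) * s (t - r) + s (r - q) * s (t - p).
Proof.
rewrite /= /s_kappa; case: ifPn => k0; last case: ifPn => kn0; last 2 first.
- by ring.
- rewrite !mulrBr /sinh !opprB; set c := Num.sqrt (- k).
  have cN0 : c != 0.
    by rewrite gt_eqF// sqrtr_gt0 oppr_gt0 lt_neqAle kn0 leNgt.
  have E x y : expR (x - y) = expR x / expR y by rewrite expRD expRN.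
  by rewrite !E; field; rewrite cN0 !expR_eq0.
rewrite !mulrBr; set c := Num.sqrt k.
set P := c * p; set Q := c * q; set X := c * r; set T := c * t.
have c2 (y : R) : cos y ^+ 2 = 1 - sin y ^+ 2 by rewrite -(cos2Dsin2 y) addrK.
have cN0 : c != 0 by rewrite gt_eqF// sqrtr_gt0.
rewrite !sinB; field: (c2 P) (c2 Q) (c2 X) (c2 T).
by [].
Qed.

(** Truncating at 0 gives an extension of the power function that is continuous
    on the whole line, while [powR] itself jumps to 1 at negative arguments. *)
Lemma continuous_powR_max0 (R : realType) (p : R) : 0 < p ->
  continuous (fun x : R => Num.max 0 x `^ p : R).
Proof.
move=> p0; suff H (x : R) : Num.max 0 y `^ p @[y --> x] --> Num.max 0 x `^ p by [].
have [x0|x0|x0] := ltgtP 0 x.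
- apply: (@cvg_trans _ ((fun y => expR (p * ln y)) y @[y --> x])).
    apply: near_eq_cvg; near=> y.
    have y0 : 0 < y by near: y; exact: lt_nbhsr.
    by rewrite /powR max_r ?(ltW y0)// gt_eqF.
  rewrite /powR gt_eqF//.
  apply: (@continuous_comp _ _ _ (fun y => p * ln y) (@expR R)).
    by apply: cvgMl_tmp; apply: (continuous_ln x0).
  exact: continuous_expR.
- rewrite powR0 ?gt_eqF//; apply: cvg_near_cst; near=> y.
  have y0 : y < 0 by near: y; exact: lt_nbhsl.
  by rewrite max_l ?(ltW y0)// powR0// gt_eqF.
- rewrite -x0 powR0 ?gt_eqF//.
  apply/cvgrPdist_lt => e e0; near=> y.
  rewrite sub0r normrN ger0_norm ?powR_ge0//.
  have ep : 0 < e `^ p^-1 by rewrite powR_gt0.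
  have -> : e = (e `^ p^-1) `^ p by rewrite -powRrM mulVf ?gt_eqF// powRr1// ltW.
  apply: gt0_ltr_powR => //; rewrite ?nnegrE ?le_max ?lexx ?(ltW ep)//.
  rewrite gt_max ep/=; near: y.
  by apply: lt_nbhsl; rewrite powR_gt0.
Unshelve. all: by end_near. Qed.

(** * Integrals of continuous functions over segments *)

Section integrals_of_continuous_functions.
Context {R : realType}.
Implicit Types (f g : R -> R) (p q r c : R).

Lemma continuous_integrable_segment f p q : continuous f ->
  leb.-integrable `[p, q] (EFin \o f).
Proof.
move=> cf; apply: continuous_compact_integrable; first exact: segment_compact.
exact: continuous_subspaceT.
Qed.

Lemma le_integral_segment f g p q : continuous f -> continuous g ->
  (forall x, p <= x <= q -> f x <= g x) ->
  \int[leb]_(x in `[p, q]) f x <= \int[leb]_(x in `[p, q]) g x.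
Proof.
move=> cf cg fg; apply: le_Rintegral => //.
- exact: continuous_integrable_segment.
- exact: continuous_integrable_segment.
Qed.

Lemma integral_segment_cst c p q : p <= q ->
  \int[leb]_(x in `[p, q]) c = c * (q - p).
Proof.
move=> pq; rewrite Rintegral_cst//= lebesgue_measure_itv/= lte_fin.
move: pq; rewrite le_eqVlt => /predU1P[->|pq]; first by rewrite ltxx subrr.
by rewrite pq.
Qed.

Lemma integral_segment_ge f c p q : continuous f -> p <= q ->
  (forall x, p <= x <= q -> c <= f x) ->
  c * (q - p) <= \int[leb]_(x in `[p, q]) f x.
Proof.
move=> cf pq cle; rewrite -integral_segment_cst//.
by apply: le_integral_segment => //; exact: cst_continuous.
Qed.

Lemma integral_segment_le f c p q : continuous f -> p <= q ->
  (forall x, p <= x <= q -> f x <= c) ->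
  \int[leb]_(x in `[p, q]) f x <= c * (q - p).
Proof.
move=> cf pq cle; rewrite -integral_segment_cst//.
by apply: le_integral_segment => //; exact: cst_continuous.
Qed.

Lemma integral_segmentZ f c p q : continuous f ->
  \int[leb]_(x in `[p, q]) (c * f x) = c * \int[leb]_(x in `[p, q]) f x.
Proof.
move=> cf; rewrite RintegralZl//.
exact: continuous_integrable_segment.
Qed.

Lemma integral_segment_cat f p q r : continuous f -> p <= q -> q <= r ->
  \int[leb]_(x in `[p, r]) f x =
  \int[leb]_(x in `[p, q]) f x + \int[leb]_(x in `[q, r]) f x.
Proof.
move=> cf pq qr; apply/eqP; rewrite addrC -subr_eq; apply/eqP.
rewrite Rintegral_itvB ?bnd_simp//; last exact: continuous_integrable_segment.
rewrite Rintegral_itv_obnd_cbnd//.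
apply: (@integrableS _ _ _ leb `[q, r]) => //; first exact: subset_itv_oc_cc.
exact: continuous_integrable_segment.
Qed.

Lemma integral_segment_reflect f c p q : continuous f -> p <= q ->
  \int[leb]_(x in `[p, q]) f (c - x) =
  \int[leb]_(x in `[c - q, c - p]) f x.
Proof.
move=> cf pq.
have dF (x : R) : is_derive x 1 (fun x => c - x) (- 1).
  have -> : (fun x => c - x) = cst c - id by [].
  have -> : - 1 = 0 - 1 :> R by rewrite sub0r.
  by apply: is_deriveB.
have F' : derive1 (fun x => c - x) = cst (- 1 : R).
  by apply/funext => x; rewrite derive1E derive_val.
rewrite /Rintegral; congr fine; apply/esym.
rewrite (@integration_by_substitution_decreasing R (fun x => c - x) f p q)//.
- by apply: eq_integral => x _; rewrite !fctE F' opprK mulr1.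
- by move=> x y _ _ xy; rewrite ltrD2l ltrN2.
- by rewrite F' => x _; exact: cst_continuous.
- by rewrite F'; exact: is_cvg_cst.
- by rewrite F'; exact: is_cvg_cst.
- have cF : continuous (fun x : R => c - x).
    by move=> x; apply: cvgB; [exact: cvg_cst|exact: cvg_id].
  split.
  + by move=> x _; exact: ex_derive.
  + exact/cvg_at_right_filter/cF.
  + exact/cvg_at_left_filter/cF.
- exact: continuous_subspaceT.
Qed.

Lemma integral_segment_gt0 f p q : continuous f -> p < q ->
  (forall x, p <= x <= q -> 0 <= f x) ->
  (forall x, p < x < q -> 0 < f x) ->
  0 < \int[leb]_(x in `[p, q]) f x.
Proof.
move=> cf pq f0 fp; pose p' := (2 * p + q) / 3; pose q' := (p + 2 * q) / 3.
have [pp' p'q' q'q] : [/\ p < p', p' < q' & q' < q].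
  by rewrite /p' /q'; split; lra.
(* on the middle third f has a positive minimum *)
have [c cpq cmin] : exists2 c, c \in `[p', q'] &
    forall t, t \in `[p', q'] -> f c <= f t.
  apply: EVT_min; first exact: ltW.
  exact: continuous_subspaceT.
have fc : 0 < f c.
  by move: cpq; rewrite in_itv/= => /andP[? ?]; apply: fp; lra.
have I0 u w : u <= w -> p <= u -> w <= q -> 0 <= \int[leb]_(x in `[u, w]) f x.
  move=> uw pu wq; rewrite -[leLHS](mul0r (w - u)).
  apply: integral_segment_ge => // x /andP[? ?].
  by apply: f0; lra.
rewrite (@integral_segment_cat _ _ p')//; [|lra..].
rewrite (@integral_segment_cat _ p' q')//; [|lra..].
apply: ltr_wpDl; first by apply: I0; lra.
apply: ltr_wpDr; first by apply: I0; lra.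
apply: (@lt_le_trans _ _ (f c * (q' - p'))); first by rewrite mulr_gt0// subr_gt0.
apply: integral_segment_ge => //; first exact: ltW.
Qed.

End integrals_of_continuous_functions.

(** * Ptolemaic functions and contracting densities *)

(** The two inequalities left from Ptolemy's identity when one of its
    nonnegative terms is dropped.  They are homogeneous, so that a power of a
    function satisfying them satisfies them too. *)
Record ptolemaic {R : realType} (D : R) (phi : R -> R) : Prop := Ptolemaic {
  ptolemaic_continuous : continuous phi;
  ptolemaic_ge0 : forall x : R, 0 <= phi x;
  ptolemaic_gt0 : forall x : R, 0 < x < D -> 0 < phi x;
  ptolemaic_sides : forall p q r t : R, p <= q -> q <= r -> r <= t -> t - p <= D ->
    phi (q - p) * phi (t - r) <= phi (r - p) * phi (t - q);
  ptolemaic_middle : forall p q r t : R, p <= q -> q <= r -> r <= t -> t - p <= D ->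
    phi (r - q) * phi (t - p) <= phi (r - p) * phi (t - q) }.

(** The MCP condition with denominators cleared.  In this form it also covers
    the distances at which sigma is infinite, because phi vanishes there. *)
Definition contracting {R : realType} (D : R) (phi h : R -> R) : Prop :=
  forall x0 x x1 : R, 0 <= x0 -> x0 <= x -> x <= x1 -> x1 <= D ->
    h x0 * phi (x1 - x) <= h x * phi (x1 - x0) /\
    h x1 * phi (x - x0) <= h x * phi (x1 - x0).

(** The best constant c in mu [0, b] <= c h(b) for contracting densities h; its
    reciprocal is the least value at b of such a density when [0, b] has mass
    1. *)
Definition cap {R : realType} (D : R) (phi : R -> R) (b : R) : R :=
  (\int[lebesgue_measure]_(x in `[0, b]) phi (D - x)) / phi (D - b).

(** The density h_a divided by its value at a.  Writing it as a maximum rather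
    than by cases makes continuity and the contraction property immediate. *)
Definition peak {R : realType} (D : R) (phi : R -> R) (a x : R) : R :=
  Num.max (phi (D - x) / phi (D - a)) (phi x / phi a).

Lemma continuous_reflect (R : realType) (f : R -> R) (c : R) :
  continuous f -> continuous (fun x => f (c - x)).
Proof.
move=> cf x; apply: (@continuous_comp _ _ _ (fun x => c - x) f); last exact: cf.
by apply: cvgB; [exact: cvg_cst|exact: cvg_id].
Qed.

Lemma continuous_shift (R : realType) (f : R -> R) (c : R) :
  continuous f -> continuous (fun x => f (c + x)).
Proof.
move=> cf x; apply: (@continuous_comp _ _ _ (fun x => c + x) f); last exact: cf.
by apply: cvgD; [exact: cvg_cst|exact: cvg_id].
Qed.

(** Reflecting [0, b] puts the parameter b inside the integrand only through
    the ratio phi (w + x) / phi w at w = D - b, which Ptolemy's inequality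
    makes monotone in w. *)
Lemma cap_shift (R : realType) (D : R) (phi : R -> R) (b : R)
  (phiP : ptolemaic D phi) : 0 <= b ->
  cap D phi b = (\int[leb]_(x in `[0, b]) phi (D - b + x)) / phi (D - b).
Proof.
have [cphi phi_ge0 phi_gt0 _ _] := phiP.
have cshift c := @continuous_shift _ _ c cphi.
move=> b0; congr (_ / _).
have /(_ _ _ b0) := @integral_segment_reflect R (fun x => phi (D - b + x)) b 0.
rewrite subrr subr0 => <-//.
by apply: eq_Rintegral => x _; congr phi; ring.
Qed.

Lemma cap_reflect (R : realType) (D : R) (phi : R -> R) (a : R)
  (phiP : ptolemaic D phi) : 0 <= a <= D ->
  (\int[leb]_(x in `[a, D]) phi x) / phi a = cap D phi (D - a).
Proof.
have [cphi phi_ge0 phi_gt0 _ _] := phiP.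
move=> /andP[a0 aD]; rewrite /cap subKr; congr (_ / _).
have := @integral_segment_reflect R phi D 0 (D - a) cphi.
by rewrite subKr subr0 subr_ge0 => ->.
Qed.

Lemma cap_gt0 (R : realType) (D : R) (phi : R -> R) (b : R)
  (phiP : ptolemaic D phi) : 0 < b < D -> 0 < cap D phi b.
Proof.
have [cphi phi_ge0 phi_gt0 _ _] := phiP.
have crefl c := @continuous_reflect _ _ c cphi.
move=> /andP[b0 bD]; rewrite divr_gt0 ?phi_gt0//; last by lra.
apply: integral_segment_gt0 => //.
by move=> x /andP[? ?]; apply: phi_gt0; lra.
Qed.

Lemma cap_le (R : realType) (D : R) (phi : R -> R) (b c : R)
  (phiP : ptolemaic D phi) : 0 < b -> b <= c -> c < D -> cap D phi b <= cap D phi c.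
Proof.
have [cphi phi_ge0 phi_gt0 _ _] := phiP.
have crefl c := @continuous_reflect _ _ c cphi.
have cshift c := @continuous_shift _ _ c cphi.
move=> b0 bc cD; have [Sb Sc] : 0 < phi (D - b) /\ 0 < phi (D - c).
  by split; apply: phi_gt0; lra.
rewrite !(cap_shift phiP); [|lra..].
rewrite ler_pdivrMr// mulrAC ler_pdivlMr// ![_ * phi _]mulrC.
rewrite -!integral_segmentZ//.
apply: (@le_trans _ _ (\int[leb]_(x in `[0, b]) (phi (D - b) * phi (D - c + x)))).
  apply: le_integral_segment.
  - by move=> x; apply: cvgMl_tmp; exact: continuous_shift.
  - by move=> x; apply: cvgMl_tmp; exact: continuous_shift.
  move=> x /andP[x0 xb].
  have := @ptolemaic_middle _ _ _ phiP 0 x (x + (D - c)) (D - b + x).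
  rewrite !subr0 addrK (addrC x) addrK => h.
  by rewrite [leRHS]mulrC; apply: h; lra.
rewrite (@integral_segment_cat _ _ 0 b c)//; [|by move=> x; apply: cvgMl_tmp; exact: continuous_shift|lra].
rewrite lerDl Rintegral_ge0// => x _; exact: mulr_ge0.
Qed.

(** When D is maximal phi vanishes at D, so the quotient defining [cap] cannot
    be evaluated in the limit b = 0.  The integrand of the shifted form is
    bounded instead by its value at w = D / 2, uniformly for b <= D / 2. *)
Lemma cap_small (R : realType) (D : R) (phi : R -> R) (e : R)
  (D_gt0 : 0 < D) (phiP : ptolemaic D phi) : 0 < e -> exists b : R, [/\ 0 < b, b <= D / 2 & cap D phi b < e].
Proof.
have [cphi phi_ge0 phi_gt0 _ _] := phiP.
have cshift c := @continuous_shift _ _ c cphi.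
move=> e0; have D2 : 0 < D / 2 by lra.
have S2 : 0 < phi (D / 2) by apply: phi_gt0; lra.
have [m _ mmax] := @EVT_max R phi 0 D (ltW D_gt0) (continuous_subspaceT cphi).
pose M := phi m / phi (D / 2).
have M0 : 0 <= M by rewrite divr_ge0.
pose b := Num.min (D / 2) (e / (M + 1)).
have b0 : 0 < b by rewrite lt_min D2 divr_gt0//; lra.
have bD2 : b <= D / 2 by rewrite ge_min lexx.
exists b; split => //.
have be : b * (M + 1) <= e by rewrite -ler_pdivlMr ?ge_min ?lexx ?orbT//; lra.
suff : cap D phi b <= M * b by nra.
rewrite (cap_shift phiP) ?(ltW b0)// ler_pdivrMr ?phi_gt0//; last by lra.
have -> : M * b * phi (D - b) = M * phi (D - b) * (b - 0) by ring.
apply: integral_segment_le => //; first exact: ltW.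
move=> x /andP[x0 xb]; rewrite /M mulrAC ler_pdivlMr//.
have := @ptolemaic_middle _ _ _ phiP 0 x (x + D / 2) (D - b + x).
rewrite !subr0 (addrC x) !addrK.
move=> /(_ x0)h; rewrite mulrC (le_trans (h _ _ _))//; [lra..|].
by rewrite ler_wpM2r// mmax// in_itv/=; lra.
Qed.

(** The intermediate value theorem is applied to the difference of the two
    sides multiplied by phi a * phi (D - a), which has no denominators.  Near
    the ends of ]0, D[ one of the two caps is small while the other one stays
    above its value at D / 2. *)
Lemma cap_balance (R : realType) (D : R) (phi : R -> R) (v : R)
  (D_gt0 : 0 < D) (phiP : ptolemaic D phi) : 0 < v < 1 ->
  exists2 a : R, 0 < a < D & (1 - v) * cap D phi a = v * cap D phi (D - a).
Proof.
have [cphi phi_ge0 phi_gt0 _ _] := phiP.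
have crefl c := @continuous_reflect _ _ c cphi.
move=> /andP[v0 v1]; have D2 : 0 < D / 2 < D by lra.
have c2 := cap_gt0 phiP D2.
have [a1 [a10 a1D c1]] : exists b : R, [/\ 0 < b, b <= D / 2 &
    cap D phi b < Num.min v (1 - v) * cap D phi (D / 2)].
  by apply: (cap_small D_gt0 phiP); rewrite mulr_gt0// lt_min v0 subr_gt0.
have ca1 : 0 < cap D phi a1 by apply: (cap_gt0 phiP); lra.
have c1v : cap D phi a1 < v * cap D phi (D / 2).
  by apply: lt_le_trans c1 _; rewrite ler_pM2r// ge_min lexx.
have c1v' : cap D phi a1 < (1 - v) * cap D phi (D / 2).
  by apply: lt_le_trans c1 _; rewrite ler_pM2r// ge_min lexx orbT.
have c2' : cap D phi (D / 2) <= cap D phi (D - a1) by apply: (cap_le phiP); lra.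
pose G b := \int[leb]_(x in `[0, b]) phi (D - x).
pose H b := \int[leb]_(x in `[0, b]) phi x.
pose psi b := (1 - v) * (G b * phi b) - v * ((H D - H b) * phi (D - b)).
have psiE b : 0 < b < D ->
    psi b = phi b * phi (D - b) * ((1 - v) * cap D phi b - v * cap D phi (D - b)).
  move=> /andP[b0 bD].
  rewrite -(cap_reflect phiP); last by lra.
  have -> : \int[leb]_(x in `[b, D]) phi x = H D - H b.
    by rewrite /H (@integral_segment_cat _ _ 0 b D)//; [ring|lra..].
  rewrite /cap -/(G b) /psi; field.
  by rewrite !gt_eqF// phi_gt0//; lra.
have cpsi : {within `[a1, D - a1], continuous psi}.
  have sub : `[a1, D - a1] `<=` `[0, D].
    by move=> x /=; rewrite !in_itv/= => /andP[? ?]; lra.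
  have cint (g : R -> R) : continuous g ->
      {within `[a1, D - a1], continuous (fun b => \int[leb]_(x in `[0, b]) g x)}.
    move=> cg; apply: continuous_subspaceW sub _.
    apply: parameterized_integral_continuous; first exact: ltW.
    exact: continuous_integrable_segment.
  have cphis : {within `[a1, D - a1], continuous phi} by exact: continuous_subspaceT.
  have cphir : {within `[a1, D - a1], continuous (fun b => phi (D - b))}.
    exact: continuous_subspaceT.
  have cG := cint _ (crefl D).
  have cH := cint _ cphi.
  move=> x; apply: cvgB.
    by apply: cvgMl_tmp; apply: cvgM; [exact: cG|exact: cphis].
  apply: cvgMl_tmp; apply: cvgM; last exact: cphir.
  by apply: cvgB; [exact: cvg_cst|exact: cH].
have p1 : psi a1 < 0.
  rewrite psiE; last by lra.
  rewrite pmulr_rlt0 ?mulr_gt0 ?phi_gt0//; [nra|lra|lra].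
have p2 : 0 < psi (D - a1).
  rewrite psiE; last by lra.
  rewrite pmulr_rgt0 ?mulr_gt0 ?phi_gt0// ?subKr; [nra|lra|lra].
have [a] : exists2 c, c \in `[a1, D - a1] & psi c = 0.
  apply: IVT => //; first by lra.
  by rewrite ge_min le_max (ltW p1) (ltW p2) orbT.
rewrite in_itv/= => /andP[aa1 aa2] pa; exists a; first by lra.
move: pa; rewrite psiE; last by lra.
move=> /eqP; rewrite mulf_eq0 subr_eq0 => /orP[|/eqP//].
by rewrite gt_eqF// mulr_gt0// phi_gt0//; lra.
Qed.

(** Comparison with x1 = D bounds h on [0, b] by h(b) phi (D - x) / phi (D -
    b); monotonicity of [cap] then replaces b by any larger c. *)
Lemma left_mass_le (R : realType) (D : R) (phi : R -> R) (h : R -> R)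
  (ch : continuous h) (h_ge0 : forall x, 0 <= h x) (hphi : contracting D phi h)
  (c b : R) (phiP : ptolemaic D phi) : 0 < c < D -> 0 <= b <= c ->
  \int[leb]_(x in `[0, b]) h x <= cap D phi c * h b.
Proof.
have [cphi phi_ge0 phi_gt0 _ _] := phiP.
have crefl c := @continuous_reflect _ _ c cphi.
move=> /andP[c0 cD] /andP[]; rewrite le_eqVlt => /predU1P[<- _|b0 bc].
  by rewrite set_itv1 Rintegral_set1 mulr_ge0// ltW// (cap_gt0 phiP)// c0.
have Sb : 0 < phi (D - b) by apply: phi_gt0; lra.
apply: (@le_trans _ _ (cap D phi b * h b)); last by rewrite ler_wpM2r// cap_le.
rewrite /cap mulrAC ler_pdivlMr// mulrC [leRHS]mulrC.
rewrite -!integral_segmentZ//; apply: le_integral_segment.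
- by move=> x; apply: cvgMl_tmp; exact: ch.
- by move=> x; apply: cvgMl_tmp; exact: continuous_reflect.
- move=> x /andP[x0 xb].
  have [+ _] := hphi x b D x0 xb (ltW (le_lt_trans bc cD)) (lexx D).
  by rewrite mulrC.
Qed.

(** The mirror image, from the comparison with x0 = 0. *)
Lemma right_mass_le (R : realType) (D : R) (phi : R -> R) (h : R -> R)
  (ch : continuous h) (h_ge0 : forall x, 0 <= h x) (hphi : contracting D phi h)
  (c b : R) (phiP : ptolemaic D phi) : 0 < c < D -> c <= b <= D ->
  \int[leb]_(x in `[b, D]) h x <= cap D phi (D - c) * h b.
Proof.
have [cphi phi_ge0 phi_gt0 _ _] := phiP.
move=> /andP[c0 cD] /andP[cb]; rewrite le_eqVlt => /predU1P[->|bD].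
  by rewrite set_itv1 Rintegral_set1 mulr_ge0// ltW// (cap_gt0 phiP)//; lra.
have Sb : 0 < phi b by apply: phi_gt0; lra.
apply: (@le_trans _ _ (cap D phi (D - b) * h b)); last first.
  by rewrite ler_wpM2r// (cap_le phiP)//; lra.
rewrite -(cap_reflect phiP); last by lra.
rewrite mulrAC ler_pdivlMr// mulrC [leRHS]mulrC.
rewrite -!integral_segmentZ//; apply: le_integral_segment.
- by move=> x; apply: cvgMl_tmp; exact: ch.
- by move=> x; apply: cvgMl_tmp; exact: cphi.
- move=> x /andP[bx xD].
  have [_] := hphi 0 b x (lexx 0) (le_trans (ltW c0) cb) bx xD.
  by rewrite !subr0 mulrC.
Qed.

Lemma peak_left (R : realType) (D : R) (phi : R -> R) (a x : R)
  (phiP : ptolemaic D phi) (aD : 0 < a < D) : 0 <= x <= a -> peak D phi a x = phi (D - x) / phi (D - a).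
Proof.
have [cphi phi_ge0 phi_gt0 _ _] := phiP.
have Sa : 0 < phi a by exact: phi_gt0.
have SDa : 0 < phi (D - a) by apply: phi_gt0; lra.
move=> /andP[x0 xa]; apply: max_l.
rewrite ler_pdivrMr// mulrAC ler_pdivlMr//.
have := @ptolemaic_sides _ _ _ phiP 0 x a D.
by rewrite !subr0 => h; rewrite [leRHS]mulrC; apply: h; lra.
Qed.

Lemma peak_right (R : realType) (D : R) (phi : R -> R) (a x : R)
  (phiP : ptolemaic D phi) (aD : 0 < a < D) : a <= x <= D -> peak D phi a x = phi x / phi a.
Proof.
have [cphi phi_ge0 phi_gt0 _ _] := phiP.
have Sa : 0 < phi a by exact: phi_gt0.
have SDa : 0 < phi (D - a) by apply: phi_gt0; lra.
move=> /andP[ax xD]; apply: max_r.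
rewrite ler_pdivrMr// mulrAC ler_pdivlMr//.
have := @ptolemaic_sides _ _ _ phiP 0 a x D.
by rewrite !subr0 [phi (D - x) * _]mulrC; apply; lra.
Qed.

Lemma peak_at (R : realType) (D : R) (phi : R -> R) (a : R)
  (phiP : ptolemaic D phi) (aD : 0 < a < D) : peak D phi a a = 1.
Proof.
have [_ _ phi_gt0 _ _] := phiP.
rewrite /peak !divff ?gt_eqF ?phi_gt0//; last by lra.
by rewrite max_l.
Qed.

Lemma peak_ge0 (R : realType) (D : R) (phi : R -> R) (a x : R)
  (phiP : ptolemaic D phi) : 0 <= peak D phi a x.
Proof.
by have [_ phi_ge0 _ _ _] := phiP; rewrite /peak le_max divr_ge0.
Qed.

Lemma peak_continuous (R : realType) (D : R) (phi : R -> R) (a : R)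
  (phiP : ptolemaic D phi) : continuous (peak D phi a).
Proof.
have [cphi phi_ge0 phi_gt0 _ _] := phiP.
have crefl c := @continuous_reflect _ _ c cphi.
move=> x; apply: (@continuous_max _ _ (fun x => phi (D - x) / phi (D - a))
  (fun x => phi x / phi a)).
  by apply: cvgMr_tmp; exact: continuous_reflect.
by apply: cvgMr_tmp; exact: cphi.
Qed.

Lemma peak_left_mass (R : realType) (D : R) (phi : R -> R) (a : R)
  (phiP : ptolemaic D phi) (aD : 0 < a < D) :
  \int[leb]_(x in `[0, a]) peak D phi a x = cap D phi a.
Proof.
have [cphi phi_ge0 phi_gt0 _ _] := phiP.
have crefl c := @continuous_reflect _ _ c cphi.
rewrite /cap mulrC -integral_segmentZ//.
apply: eq_Rintegral => x; rewrite inE/= in_itv/= => xa.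
by rewrite (peak_left phiP)// mulrC.
Qed.

Lemma peak_right_mass (R : realType) (D : R) (phi : R -> R) (a : R)
  (phiP : ptolemaic D phi) (aD : 0 < a < D) :
  \int[leb]_(x in `[a, D]) peak D phi a x = cap D phi (D - a).
Proof.
have [cphi phi_ge0 phi_gt0 _ _] := phiP.
rewrite -(cap_reflect phiP); last by lra.
rewrite mulrC -integral_segmentZ//.
apply: eq_Rintegral => x; rewrite inE/= in_itv/= => xa.
by rewrite (peak_right phiP)// mulrC.
Qed.

(** Each of phi (D - x) and phi x satisfies both inequalities: these are the
    ptolemaic inequalities for x0, x, x1, D and for 0, x0, x, x1. *)
Lemma peak_contracting (R : realType) (D : R) (phi : R -> R) (a : R)
  (phiP : ptolemaic D phi) (aD : 0 < a < D) : contracting D phi (peak D phi a).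
Proof.
have [cphi phi_ge0 phi_gt0 _ _] := phiP.
have Sa : 0 < phi a by exact: phi_gt0.
have SDa : 0 < phi (D - a) by apply: phi_gt0; lra.
have comb (u u' w w' c c' d d' : R) : 0 < d -> 0 < d' -> 0 <= c -> 0 <= c' ->
    u * c <= u' * c' -> w * c <= w' * c' ->
    Num.max (u / d) (w / d') * c <= Num.max (u' / d) (w' / d') * c'.
  move=> d0 d'0 c0 c'0 uu ww; rewrite !maxr_pMl//.
  rewrite ge_max !le_max; apply/andP; split; apply/orP; [left|right].
    by rewrite mulrAC [leRHS]mulrAC ler_pM2r// invr_gt0.
  by rewrite mulrAC [leRHS]mulrAC ler_pM2r// invr_gt0.
move=> x0 x x1 h0 h1 h2 h3; split; apply: comb => //.
- have := @ptolemaic_middle _ _ _ phiP x0 x x1 D.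
  by move=> h; rewrite mulrC [leRHS]mulrC; apply: h; lra.
- have := @ptolemaic_sides _ _ _ phiP 0 x0 x x1.
  by rewrite !subr0; apply; lra.
- have := @ptolemaic_sides _ _ _ phiP x0 x x1 D.
  by move=> h; rewrite mulrC [leRHS]mulrC; apply: h; lra.
- have := @ptolemaic_middle _ _ _ phiP 0 x0 x x1.
  by rewrite !subr0 => h; rewrite mulrC; apply: h; lra.
Qed.

(** * Enlargements and the outer Minkowski content *)

Lemma enlargementP (R : realType) (A : set R) (eps x : R) :
  enlargement A eps x <-> exists2 y, A y & `|x - y| < eps.
Proof.
rewrite /enlargement/= /edist_inf; split.
  move=> /ereal_inf_lt[_ [y Ay <-]] /edist_lt_ball xy.
  by exists y.
move=> [y Ay xy]; pose r := (`|x - y| + eps) / 2.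
have [xr re] : `|x - y| < r /\ r < eps by rewrite /r; split; lra.
apply: (@le_lt_trans _ _ r%:E); last by rewrite lte_fin.
apply: (@le_trans _ _ (edist (x, y))).
  by apply: ereal_inf_lbound; exists y.
by apply: edist_fin => //; exact: le_lt_trans xr.
Qed.

Lemma open_enlargement (R : realType) (A : set R) (eps : R) :
  open (enlargement A eps).
Proof.
rewrite openE => x /enlargementP[y Ay xy].
exists (eps - `|x - y|); first by rewrite /= subr_gt0.
move=> z /= xz; apply/enlargementP; exists y => //.
have -> : z - y = (x - y) - (x - z) by ring.
by rewrite (le_lt_trans (ler_normB _ _))//; lra.
Qed.

Lemma measurable_enlargement (R : realType) (A : set (measurableTypeR R)) (eps : R) :
  measurable (enlargement A eps : set (measurableTypeR R)).
Proof. by apply: open_measurable; exact: open_enlargement. Qed.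

Lemma measurable_closure (R : realType) (A : set (measurableTypeR R)) :
  measurable (closure (A : set R) : set (measurableTypeR R)).
Proof. by apply: closed_measurable; exact: closed_closure. Qed.

Lemma enlargement_closure (R : realType) (A : set R) (eps q x : R) :
  closure A q -> `|x - q| < eps -> enlargement A eps x.
Proof.
move=> Aq xq; apply/enlargementP.
have e0 : 0 < eps - `|x - q| by rewrite subr_gt0.
have [y [Ay qy]] := Aq _ (nbhsx_ballx q _ e0).
exists y => //; have -> : x - y = (x - q) + (q - y) by ring.
by rewrite (le_lt_trans (ler_normD _ _))//; move: qy; rewrite /ball/=; lra.
Qed.

Section real_valued_probability.
Context (R : realType) (mu : probability (measurableTypeR R) R).
Implicit Types A B : set (measurableTypeR R).

Lemma fine_probability A : measurable A -> (fine (mu A))%:E = mu A.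
Proof. by move=> mA; rewrite fineK// fin_num_measure. Qed.

Lemma fine_probability_ge0 A : 0 <= fine (mu A).
Proof. exact: fine_ge0. Qed.

Lemma le_fine_probability A B : measurable A -> measurable B -> A `<=` B ->
  fine (mu A) <= fine (mu B).
Proof.
move=> mA mB AB; rewrite -lee_fin !fine_probability//.
by apply: le_measure => //; rewrite inE.
Qed.

Lemma fine_probability_subadd A B C : measurable A -> measurable B ->
  measurable C -> C `<=` A `|` B -> fine (mu C) <= fine (mu A) + fine (mu B).
Proof.
move=> mA mB mC CAB; rewrite -lee_fin EFinD !fine_probability//.
apply: le_trans (measureU2 _ mA mB).
by apply: le_measure => //; rewrite inE//; exact: measurableU.
Qed.

Lemma fine_probability_superadd A B C : measurable A -> measurable B ->
  measurable C -> [disjoint A & B] -> A `<=` C -> B `<=` C ->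
  fine (mu A) + fine (mu B) <= fine (mu C).
Proof.
move=> mA mB mC /disj_set2P AB AC BC.
rewrite -lee_fin EFinD !fine_probability// -measureU//.
by apply: le_measure => //; rewrite ?inE ?subUset//; exact: measurableU.
Qed.

End real_valued_probability.

Lemma muplus_ge (R : realType) (mu : probability (measurableTypeR R) R)
    (A : set (measurableTypeR R)) (L delta : R) : measurable A -> 0 < delta ->
  (forall eps, 0 < eps < delta ->
     L * eps <= fine (mu (enlargement A eps)) - fine (mu A)) ->
  (L%:E <= muplus mu A)%E.
Proof.
move=> mA d0 h; rewrite /muplus limf_einfE; apply: ereal_sup_ge.
exists (ereal_inf ((fun eps => (mu (enlargement A eps) - mu A) * eps^-1%:E)%E @`
    `]0, delta[)).
  exists `]0, delta[%classic => //; near=> e; rewrite /= in_itv/=.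
  by apply/andP; split; near: e; [exact: nbhs_right_gt|exact: nbhs_right_lt].
apply: le_ereal_inf_tmp => _ [e /= + <-]; rewrite in_itv/= => /andP[e0 ed].
rewrite -(fine_probability _ (measurable_enlargement A e)) -(fine_probability mu mA).
rewrite -EFinB -EFinM lee_fin ler_pdivlMr//.
by apply: h; rewrite e0.
Unshelve. all: by end_near. Qed.

Lemma muplus_le (R : realType) (mu : probability (measurableTypeR R) R)
    (A : set (measurableTypeR R)) (L delta : R) : measurable A -> 0 < delta ->
  (forall eps, 0 < eps < delta ->
     fine (mu (enlargement A eps)) - fine (mu A) <= L * eps) ->
  (muplus mu A <= L%:E)%E.
Proof.
move=> mA d0 h; rewrite /muplus limf_einfE; apply: ge_ereal_sup => _ [V V0 <-].
have [e [/andP[e0 ed] Ve]] : exists e : R, 0 < e < delta /\ V e.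
  have F : 0^'+ (`]0, delta[%classic `&` V).
    apply: filterI => //; near=> e; rewrite /= in_itv/=.
    by apply/andP; split; near: e; [exact: nbhs_right_gt|exact: nbhs_right_lt].
  have [e [/=]] := filter_ex F.
  by rewrite in_itv/= => ? ?; exists e.
apply: ereal_inf_le; exists ((mu (enlargement A e) - mu A) * e^-1%:E)%E.
  by exists e.
rewrite -(fine_probability _ (measurable_enlargement A e)) -(fine_probability mu mA).
rewrite -EFinB -EFinM lee_fin ler_pdivrMr//.
by apply: h; rewrite e0.
Unshelve. all: by end_near. Qed.

(** * Measures with a density; growth at the ends of gaps *)

(** Continuity and nonnegativity are asked on the whole line, so that every
    integral below is one of a globally continuous function; [MCP_has_density]
    extends a density on [0, D] accordingly. *)
Record has_density (R : realType) (D : R) (h : R -> R)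
    (mu : probability (measurableTypeR R) R) : Prop := HasDensity {
  density_length : 0 < D;
  density_continuous : continuous h;
  density_ge0 : forall x : R, 0 <= h x;
  densityE : forall B : set (measurableTypeR R), measurable B ->
    mu B = (\int[leb]_(x in B `&` `[0%R, D]) (h x)%:E)%E }.

Section density.
Context (R : realType) (D : R) (h : R -> R).
Context (mu : probability (measurableTypeR R) R).
Implicit Types (p q u z c x : R) (A B : set (measurableTypeR R)).

Lemma density_segment p q : has_density D h mu -> 0 <= p -> q <= D ->
  fine (mu `[p, q]%classic) = \int[leb]_(x in `[p, q]) h x.
Proof.
move=> [D0 ch h0 muE] p0 qD; rewrite muE// setIidl// => x /=.
by rewrite !in_itv/= => /andP[? ?]; lra.
Qed.

Lemma density_open p q : has_density D h mu -> 0 <= p -> q <= D ->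
  fine (mu `]p, q[%classic) = \int[leb]_(x in `[p, q]) h x.
Proof.
move=> [D0 ch h0 muE] p0 qD; rewrite muE// setIidl => [|x /=]; last first.
  by rewrite !in_itv/= => /andP[? ?]; lra.
have i : leb.-integrable `[p, q] (EFin \o h).
  exact: continuous_integrable_segment.
rewrite -[LHS]/(\int[leb]_(x in `]p, q[) h x).
rewrite Rintegral_itv_bndo_bndc ?Rintegral_itv_obnd_cbnd//.
  by apply: integrableS i => //; exact: subset_itv_oc_cc.
by apply: integrableS i => //; exact: subset_itv_oo_cc.
Qed.

Lemma density_total p : has_density D h mu -> 0 <= p <= D ->
  fine (mu `[0, p]%classic) + fine (mu `[p, D]%classic) = 1.
Proof.
move=> hd /andP[p0 pD]; have [D0 ch h0 muE] := hd.
rewrite !density_segment//; [|lra..].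
rewrite -integral_segment_cat//.
have := probability_setT mu; rewrite muE// setTI => e.
by rewrite /Rintegral e.
Qed.

Lemma density_carrier B : has_density D h mu -> measurable B ->
  fine (mu B) = fine (mu (B `&` `[0, D]%classic)).
Proof.
move=> [D0 ch h0 muE] mB; rewrite muE// muE//; last exact: measurableI.
by rewrite -setIA setIid.
Qed.

Lemma density_compl A : has_density D h mu -> measurable A ->
  fine (mu (`[0, D]%classic `\` A)) = 1 - fine (mu A).
Proof.
move=> hd mA; have mD : measurable (`[0, D]%classic : set (measurableTypeR R)) by [].
rewrite setDE setIC -density_carrier//; last exact: measurableC.
by rewrite probability_setC// fineB// fin_num_measure.
Qed.

End density.

(** Inside I, the enlargements of A gain outside the closure of A at least P
    eps mass to first order.  The gains in disjoint sets I add up, which allows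
    the gap ends to be treated separately. *)
Definition grows_in (R : realType) (mu : probability (measurableTypeR R) R)
    (A I : set (measurableTypeR R)) (P : R) : Prop :=
  forall rho, 0 < rho -> exists2 delta, 0 < delta &
    forall eps, 0 < eps < delta ->
      (P - rho) * eps <= fine (mu ((enlargement A eps `\` closure (A : set R)) `&` I)).

Section growth.
Context (R : realType) (mu : probability (measurableTypeR R) R).
Context (A : set (measurableTypeR R)).
Hypothesis mA : measurable A.
Implicit Types (I J : set (measurableTypeR R)) (P Q : R).

Let shell eps := enlargement A eps `\` closure (A : set R).

Lemma measurable_shell (eps : R) :
  measurable (shell eps : set (measurableTypeR R)).
Proof.
apply: measurableD; first exact: measurable_enlargement.
exact: measurable_closure.
Qed.

Lemma grows_in0 I : grows_in mu A I 0.
Proof.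
move=> rho rho0; exists 1 => // eps /andP[e0 _].
apply: le_trans (fine_probability_ge0 _ _).
by rewrite sub0r mulNr oppr_le0 mulr_ge0// ltW.
Qed.

Lemma grows_in_setU I J P Q : measurable I -> measurable J ->
  [disjoint I & J] -> grows_in mu A I P -> grows_in mu A J Q ->
  grows_in mu A setT (P + Q).
Proof.
move=> mI mJ IJ gP gQ rho rho0; have rho2 : 0 < rho / 2 by rewrite divr_gt0.
have [d1 d10 h1] := gP _ rho2; have [d2 d20 h2] := gQ _ rho2.
exists (Num.min d1 d2) => [|e]; first by rewrite lt_min d10.
rewrite lt_min => /and3P[e0 e1 e2].
have -> : P + Q - rho = (P - rho / 2) + (Q - rho / 2) by field.
rewrite mulrDl; apply: (le_trans (lerD (h1 e _) (h2 e _))); rewrite ?e0//.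
apply: fine_probability_superadd.
- by apply: measurableI => //; exact: measurable_shell.
- by apply: measurableI => //; exact: measurable_shell.
- by apply: measurableI => //; exact: measurable_shell.
- move/disj_set2P : IJ => IJ; apply/disj_set2P.
  by rewrite setIACA IJ setI0.
- exact: setIS.
- exact: setIS.
Qed.

Lemma grows_in_sub I J P : measurable I -> measurable J -> I `<=` J ->
  grows_in mu A I P -> grows_in mu A J P.
Proof.
move=> mI mJ IJ g rho /g[d d0 hd]; exists d => // e /hd /le_trans; apply.
apply: le_fine_probability.
- by apply: measurableI => //; exact: measurable_shell.
- by apply: measurableI => //; exact: measurable_shell.
- exact: setIS.
Qed.

Lemma muplus_ge_growth P : grows_in mu A setT P -> (P%:E <= muplus mu A)%E.
Proof.
move=> g; apply/lee_subgt0Pr => rho rho0; rewrite -EFinB.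
have [d d0 hd] := g _ rho0.
apply: (@muplus_ge _ _ _ _ d) => // e /[dup] /andP[e0 _] /hd.
rewrite setIT lerBrDl => h; apply: le_trans (lerD (lexx _) h) _.
apply: fine_probability_superadd => //.
- exact: measurable_shell.
- exact: measurable_enlargement.
- by apply/disj_set2P; rewrite setDE setICA (@subsets_disjoint _ A _).1 ?setI0//; exact: subset_closure.
- by move=> x Ax; apply: (@enlargement_closure _ _ _ x); [exact: subset_closure|rewrite subrr normr0].
Qed.

(** The mass that the closure adds is gained by every enlargement, however
    small, so the difference quotients tend to infinity. *)
Lemma muplus_closure (L : R) : fine (mu A) < fine (mu (closure (A : set R))) ->
  (L%:E <= muplus mu A)%E.
Proof.
move=> AC; pose d := fine (mu (closure (A : set R))) - fine (mu A).
have d0 : 0 < d by rewrite subr_gt0.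
have L1 : 0 < `|L| + 1 by rewrite ltr_wpDl.
apply: (@muplus_ge _ _ _ _ (d / (`|L| + 1))) => //; first exact: divr_gt0.
move=> e /andP[e0]; rewrite ltr_pdivlMr// => eL.
apply: (@le_trans _ _ d).
  by have := ler_norm L; nra.
apply: lerD => //; apply: le_fine_probability.
- exact: measurable_closure.
- exact: measurable_enlargement.
- by move=> x Ax; apply: (@enlargement_closure _ _ _ x) => //; rewrite subrr normr0.
Qed.

End growth.

Section gap_ends.
Context (R : realType) (D : R) (h : R -> R).
Context (mu : probability (measurableTypeR R) R).
Context (A : set (measurableTypeR R)).
Implicit Types (p q u z c x M rho : R).
Let C : set R := closure (A : set R).

(** Starting from a point u of the complement, the first point q of the closure
    to the right of u is the right end of a gap.  The enlargement of radius eps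
    covers ]q - eps, q[, of mass close to h(q) eps by continuity of h. *)
Lemma gap_right_end u z : has_density D h mu ->
  ~ C u -> C z -> 0 <= u -> u < z -> z <= D ->
  exists2 q, [/\ u < q, q <= z, C q & forall x, u < x < q -> ~ C x] &
    grows_in mu A `]u, q[%classic (h q).
Proof.
move=> hd Cu Cz u0 uz zD; have [D0 ch h0 _] := hd.
have [q] : exists2 q, q \in `[u, z]%classic `&` C &
    forall t, t \in `[u, z]%classic `&` C -> id q <= id t.
  apply: compact_EVT_min.
  - by exists z; split => //=; rewrite in_itv/= lexx ltW.
  - by apply: compact_closedI; [exact: segment_compact|exact: closed_closure].
  - by apply: continuous_subspaceT => x; exact: cvg_id.
rewrite inE => -[/=]; rewrite in_itv/= => /andP[uq qz] Cq qmin.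
have {}uq : u < q by rewrite lt_neqAle uq andbT; apply/eqP => uq'; rewrite uq' in Cu.
have gap x : u < x < q -> ~ C x.
  move=> /andP[ux xq] Cx; have : q <= x.
    by apply: qmin; rewrite inE; split => //=; rewrite in_itv/=; lra.
  lra.
exists q => //; move=> rho rho0.
have /cvgrPdist_lt /(_ _ rho0) [d /= d0 hd'] := ch q.
exists (Num.min d (q - u)) => [|e]; first by rewrite lt_min d0 subr_gt0.
rewrite lt_min => /and3P[e0 ed eq].
apply: (@le_trans _ _ (fine (mu `]q - e, q[%classic))).
  rewrite (density_open hd); [|lra..].
  have -> : (h q - rho) * e = (h q - rho) * (q - (q - e)) by ring.
  apply: integral_segment_ge => //; first lra.
  move=> x /andP[x1 x2]; have [->|xq] := eqVneq x q; first lra.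
  have /hd' : `|q - x| < d by rewrite ger0_norm; lra.
  by rewrite ltr_distlC => /andP[? ?]; lra.
apply: le_fine_probability => //.
  by apply: measurableI => //; exact: measurable_shell.
move=> x /=; rewrite in_itv/= => /andP[x1 x2].
have xuq : u < x < q by lra.
split; last by rewrite /= in_itv.
split; last exact: gap.
by apply: (@enlargement_closure _ _ _ q) => //; rewrite ltr0_norm; lra.
Qed.

(** The mirror image of [gap_right_end], with the last point of the closure to
    the left of u. *)
Lemma gap_left_end u z : has_density D h mu ->
  ~ C u -> C z -> 0 <= z -> z < u -> u <= D ->
  exists2 p, [/\ z <= p, p < u, C p & forall x, p < x < u -> ~ C x] &
    grows_in mu A `]p, u[%classic (h p).
Proof.
move=> hd Cu Cz z0 zu uD; have [D0 ch h0 _] := hd.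
have [p] : exists2 q, q \in `[z, u]%classic `&` C &
    forall t, t \in `[z, u]%classic `&` C -> id t <= id q.
  apply: compact_EVT_max.
  - by exists z; split => //=; rewrite in_itv/= lexx ltW.
  - by apply: compact_closedI; [exact: segment_compact|exact: closed_closure].
  - by apply: continuous_subspaceT => x; exact: cvg_id.
rewrite inE => -[/=]; rewrite in_itv/= => /andP[zp pu] Cp pmax.
have {}pu : p < u by rewrite lt_neqAle pu andbT; apply/eqP => up'; rewrite up' in Cp.
have gap x : p < x < u -> ~ C x.
  move=> /andP[px xu] Cx; have : x <= p.
    by apply: pmax; rewrite inE; split => //=; rewrite in_itv/=; lra.
  lra.
exists p => //; move=> rho rho0.
have /cvgrPdist_lt /(_ _ rho0) [d /= d0 hd'] := ch p.
exists (Num.min d (u - p)) => [|e]; first by rewrite lt_min d0 subr_gt0.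
rewrite lt_min => /and3P[e0 ed eu].
apply: (@le_trans _ _ (fine (mu `]p, p + e[%classic))).
  rewrite (density_open hd); [|lra..].
  have -> : (h p - rho) * e = (h p - rho) * (p + e - p) by ring.
  apply: integral_segment_ge => //; first lra.
  move=> x /andP[x1 x2]; have [->|xp] := eqVneq x p; first lra.
  have /hd' : `|p - x| < d by rewrite ler0_norm; lra.
  by rewrite ltr_distlC => /andP[? ?]; lra.
apply: le_fine_probability => //.
  by apply: measurableI => //; exact: measurable_shell.
move=> x /=; rewrite in_itv/= => /andP[x1 x2].
have xpu : p < x < u by lra.
split; last by rewrite /= in_itv.
split; last exact: gap.
by apply: (@enlargement_closure _ _ _ p) => //; rewrite gtr0_norm; lra.
Qed.

End gap_ends.

(** * Sets that contain or avoid an interval *)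

Section two_sided.
Context (R : realType) (D : R) (h : R -> R).
Context (mu : probability (measurableTypeR R) R).
Context (A : set (measurableTypeR R)).
Implicit Types (b c x M rho P : R).
Let C : set (measurableTypeR R) := closure (A : set R).

(** With c in a gap, all of the closure in [0, c] lies to the left of the left
    end of that gap.  If there is no such part, P = 0 does. *)
Lemma left_of_gap c M : has_density D h mu -> ~ C c -> 0 <= c <= D ->
  (forall b, 0 <= b <= c -> fine (mu `[0, b]%classic) <= M * h b) ->
  exists2 P, grows_in mu A `]-oo, c[%classic P &
    fine (mu (C `&` `[0, c]%classic)) <= M * P.
Proof.
move=> hd Cc /andP[c0 cD] hM.
have mC : measurable C by exact: measurable_closure.
have [[z [Cz z0 zc]]|noz] := pselect (exists z, [/\ C z, 0 <= z & z < c]).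
  have [p [zp pc Cp gap] gp] := gap_left_end hd Cc Cz z0 zc cD.
  exists (h p).
    by apply: grows_in_sub gp => // x /=; rewrite !in_itv/= => /andP[].
  apply: (@le_trans _ _ (fine (mu `[0, p]%classic))); last by apply: hM; lra.
  apply: le_fine_probability => //; first exact: measurableI.
  move=> x [Cx] /=; rewrite !in_itv/= => /andP[x0 xc]; rewrite x0/= leNgt.
  apply/negP => px; move: xc; rewrite le_eqVlt => /predU1P[xc|xc].
    by apply: Cc; rewrite -xc.
  by apply: (gap x) => //; rewrite px.
exists 0; first exact: grows_in0.
rewrite (_ : C `&` _ = set0) ?measure0 ?mulr0//.
rewrite -subset0 => x [Cx] /=; rewrite in_itv/= => /andP[x0 xc].
apply: noz; exists x; split => //; rewrite lt_neqAle xc andbT.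
by apply/eqP => xc'; apply: Cc; rewrite -xc'.
Qed.

(** The mirror image of [left_of_gap]. *)
Lemma right_of_gap c M : has_density D h mu -> ~ C c -> 0 <= c <= D ->
  (forall b, c <= b <= D -> fine (mu `[b, D]%classic) <= M * h b) ->
  exists2 P, grows_in mu A `]c, +oo[%classic P &
    fine (mu (C `&` `[c, D]%classic)) <= M * P.
Proof.
move=> hd Cc /andP[c0 cD] hM.
have mC : measurable C by exact: measurable_closure.
have [[z [Cz zc zD]]|noz] := pselect (exists z, [/\ C z, c < z & z <= D]).
  have [q [cq qz Cq gap] gq] := gap_right_end hd Cc Cz c0 zc zD.
  exists (h q).
    by apply: grows_in_sub gq => // x /=; rewrite !in_itv/= andbT => /andP[].
  apply: (@le_trans _ _ (fine (mu `[q, D]%classic))); last by apply: hM; lra.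
  apply: le_fine_probability => //; first exact: measurableI.
  move=> x [Cx] /=; rewrite !in_itv/= => /andP[cx xD]; rewrite xD andbT leNgt.
  apply/negP => xq; move: cx; rewrite le_eqVlt => /predU1P[xc|xc].
    by apply: Cc; rewrite xc.
  by apply: (gap x) => //; rewrite xc.
exists 0; first exact: grows_in0.
rewrite (_ : C `&` _ = set0) ?measure0 ?mulr0//.
rewrite -subset0 => x [Cx] /=; rewrite in_itv/= => /andP[cx xD].
apply: noz; exists x; split => //; rewrite lt_neqAle cx andbT.
by apply/eqP => xc'; apply: Cc; rewrite xc'.
Qed.

Lemma density_bounded : has_density D h mu -> exists2 B : R, 0 < B &
  forall p q, 0 <= p -> p <= q -> q <= D ->
    fine (mu `[p, q]%classic) <= B * (q - p).
Proof.
move=> hd; have [D0 ch h0 _] := hd.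
have [m _ mmax] := @EVT_max R h 0 D (ltW D0) (continuous_subspaceT ch).
exists (h m + 1) => [|p q p0 pq qD]; first by rewrite ltr_wpDl.
rewrite (density_segment hd)//; apply: integral_segment_le => // x /andP[px xq].
rewrite (@le_trans _ _ (h m))//; last by rewrite lerDl.
by apply: mmax; rewrite in_itv/=; lra.
Qed.

(** Gaps may accumulate at c, so that no gap of [0, c] need be the last one.  A
    gap reaching close to the supremum of the complement is used; the mass
    beyond its right end is what rho accounts for. *)
Lemma left_of_contact c M rho : has_density D h mu -> C c -> 0 <= c <= D ->
  0 < rho ->
  (forall b, 0 <= b <= c -> fine (mu `[0, b]%classic) <= M * h b) ->
  exists2 P, grows_in mu A `]-oo, c[%classic P &
    fine (mu (`[0, c]%classic `\` C)) <= M * P + rho.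
Proof.
move=> hd Cc /andP[c0 cD] rho0 hM.
have mC : measurable C by exact: measurable_closure.
have [U0|] := eqVneq (`[0, c]%classic `\` C) set0.
  exists 0; first exact: grows_in0.
  by rewrite U0 measure0 mulr0 add0r ltW.
move=> /set0P U0.
have [B B0 hB] := density_bounded hd.
have Usup : has_sup (`[0, c]%classic `\` C).
  by split=> //; exists c => x [] /=; rewrite in_itv/= => /andP[].
pose s := sup (`[0, c]%classic `\` C).
have sc : s <= c.
  by apply: ge_sup => // x [] /=; rewrite in_itv/= => /andP[].
(* B bounds the density, so a segment of length rho / B has mass at most rho *)
have [u [] /=] := sup_adherent (divr_gt0 rho0 B0) Usup.
rewrite in_itv/= => /andP[u0 uc] Cu; rewrite -/s => su.
have us : u <= s.
  by apply: ub_le_sup; [exact: Usup.2|split => //=; rewrite in_itv/= u0].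
have {}uc : u < c by rewrite lt_neqAle uc andbT; apply/eqP => uc'; rewrite uc' in Cu.
have [q [uq qc Cq gap] gq] := gap_right_end hd Cu Cc u0 uc cD.
exists (h q).
  by apply: grows_in_sub gq => // x /=; rewrite !in_itv/= => /andP[]; lra.
apply: (@le_trans _ _ (fine (mu `[0, q]%classic) + fine (mu `[u, s]%classic))).
  apply: fine_probability_subadd => //; first exact: measurableD.
  move=> x Ux; have xs : x <= s by apply: ub_le_sup => //; exact: Usup.2.
  have [x0 _] : 0 <= x /\ x <= c by case: Ux => /=; rewrite in_itv/= => /andP[].
  have [xq|qx] := leP x q; [left|right]; rewrite /= in_itv/=; lra.
apply: lerD; first by apply: hM; lra.
apply: (le_trans (hB _ _ u0 us _)); first by lra.
by rewrite mulrC -ler_pdivlMr//; lra.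
Qed.

(** The mirror image of [left_of_contact]. *)
Lemma right_of_contact c M rho : has_density D h mu -> C c -> 0 <= c <= D ->
  0 < rho ->
  (forall b, c <= b <= D -> fine (mu `[b, D]%classic) <= M * h b) ->
  exists2 P, grows_in mu A `]c, +oo[%classic P &
    fine (mu (`[c, D]%classic `\` C)) <= M * P + rho.
Proof.
move=> hd Cc /andP[c0 cD] rho0 hM.
have mC : measurable C by exact: measurable_closure.
have [U0|] := eqVneq (`[c, D]%classic `\` C) set0.
  exists 0; first exact: grows_in0.
  by rewrite U0 measure0 mulr0 add0r ltW.
move=> /set0P U0.
have [B B0 hB] := density_bounded hd.
have Uinf : has_inf (`[c, D]%classic `\` C).
  by split=> //; exists c => x [] /=; rewrite in_itv/= => /andP[].
pose s := inf (`[c, D]%classic `\` C).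
have cs : c <= s.
  by apply: lb_le_inf => // x [] /=; rewrite in_itv/= => /andP[].
have [u [] /=] := inf_adherent (divr_gt0 rho0 B0) Uinf.
rewrite in_itv/= => /andP[cu uD] Cu; rewrite -/s => su.
have us : s <= u.
  by apply: ge_inf; [exact: Uinf.2|split => //=; rewrite in_itv/= cu].
have {}cu : c < u by rewrite lt_neqAle cu andbT; apply/eqP => uc'; rewrite -uc' in Cu.
have [p [cp pu Cp gap] gp] := gap_left_end hd Cu Cc c0 cu uD.
exists (h p).
  by apply: grows_in_sub gp => // x /=; rewrite !in_itv/= andbT => /andP[]; lra.
apply: (@le_trans _ _ (fine (mu `[p, D]%classic) + fine (mu `[s, u]%classic))).
  apply: fine_probability_subadd => //; first exact: measurableD.
  move=> x Ux; have xs : s <= x by apply: ge_inf => //; exact: Uinf.2.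
  have [_ xD] : c <= x /\ x <= D by case: Ux => /=; rewrite in_itv/= => /andP[].
  have [px|xp] := leP p x; [left|right]; rewrite /= in_itv/=; lra.
apply: lerD; first by apply: hM; lra.
apply: (le_trans (hB _ _ _ us _)); [lra..|].
by rewrite mulrC -ler_pdivlMr//; lra.
Qed.

(** The closure of A lies on the two sides of [c, c'], and each part has mass
    at most M times the density at the gap end nearest to [c, c']. *)
Lemma muplus_gap c c' M : has_density D h mu -> measurable A ->
  A `<=` `[0, D] -> 0 <= c -> c <= c' -> c' <= D -> 0 < M ->
  (forall b, 0 <= b <= c -> fine (mu `[0, b]%classic) <= M * h b) ->
  (forall b, c' <= b <= D -> fine (mu `[b, D]%classic) <= M * h b) ->
  (forall x, c <= x <= c' -> ~ C x) ->
  ((fine (mu A) / M)%:E <= muplus mu A)%E.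
Proof.
move=> hd mA AD c0 cc' c'D M0 hl hr Cn.
have mC : measurable C by exact: measurable_closure.
have [||P1 g1 m1] := left_of_gap hd _ _ hl; [by apply: Cn; lra|lra|].
have [||P2 g2 m2] := right_of_gap hd _ _ hr; [by apply: Cn; lra|lra|].
apply: (@le_trans _ _ (P1 + P2)%:E); last first.
  apply: muplus_ge_growth => //; apply: grows_in_setU g1 g2 => //.
  apply/disj_set2P; rewrite -subset0 => x [] /=; rewrite !in_itv/= andbT.
  lra.
rewrite lee_fin ler_pdivrMr// mulrC mulrDr.
apply: le_trans (lerD m1 m2); apply: fine_probability_subadd => //.
- exact: measurableI.
- exact: measurableI.
move=> x Ax; have Cx : C x by exact: subset_closure.
have /= := AD _ Ax; rewrite in_itv/= => /andP[x0 xD].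
have [xc|cx] := leP x c; first by left; split => //=; rewrite in_itv/= x0.
have [xc'|cx'] := leP x c'; first by exfalso; apply: (Cn x) => //; lra.
by right; split => //=; rewrite in_itv/= xD ltW.
Qed.

(** The same for the complement, whose parts are controlled only up to an
    arbitrarily small mass. *)
Lemma muplus_contact c c' M : has_density D h mu -> measurable A ->
  0 <= c -> c <= c' -> c' <= D -> 0 < M ->
  (forall b, 0 <= b <= c -> fine (mu `[0, b]%classic) <= M * h b) ->
  (forall b, c' <= b <= D -> fine (mu `[b, D]%classic) <= M * h b) ->
  (forall x, c <= x <= c' -> C x) ->
  (((1 - fine (mu C)) / M)%:E <= muplus mu A)%E.
Proof.
move=> hd mA c0 cc' c'D M0 hl hr Cn.
have mC : measurable C by exact: measurable_closure.
apply/lee_subgt0Pr => rho rho0; rewrite -EFinB.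
have rho2 : 0 < rho * M / 2 by rewrite divr_gt0// mulr_gt0.
have [||P1 g1 m1] := left_of_contact hd _ _ rho2 hl; [by apply: Cn; lra|lra|].
have [||P2 g2 m2] := right_of_contact hd _ _ rho2 hr; [by apply: Cn; lra|lra|].
apply: (@le_trans _ _ (P1 + P2)%:E); last first.
  apply: muplus_ge_growth => //; apply: grows_in_setU g1 g2 => //.
  apply/disj_set2P; rewrite -subset0 => x [] /=; rewrite !in_itv/= andbT.
  lra.
rewrite lee_fin lerBlDr ler_pdivrMr//.
have -> : (P1 + P2 + rho) * M = (M * P1 + rho * M / 2) + (M * P2 + rho * M / 2).
  by field.
rewrite -(density_compl hd mC).
apply: le_trans (lerD m1 m2); apply: fine_probability_subadd => //.
- exact: measurableD.
- exact: measurableD.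
- exact: measurableD.
move=> x [/=]; rewrite in_itv/= => /andP[x0 xD] Cx.
have [xc|cx] := leP x c; first by left; split => //=; rewrite in_itv/= x0.
have [xc'|cx'] := leP x c'; first by exfalso; apply/Cx/Cn; lra.
by right; split => //=; rewrite in_itv/= xD ltW.
Qed.

End two_sided.

(** * The isoperimetric inequality *)

(** Both cases below compare a with its mirror point a' = D - a, where the
    values of [cap] are exchanged. *)
Lemma muplus_ge_cap (R : realType) (D : R) (phi h : R -> R)
    (mu : probability (measurableTypeR R) R) (A : set (measurableTypeR R))
    (a v : R) :
  ptolemaic D phi -> has_density D h mu -> contracting D phi h ->
  measurable A -> A `<=` `[0, D] -> fine (mu A) = v -> 0 < a < D ->
  v * (cap D phi a + cap D phi (D - a)) = cap D phi a ->
  (((cap D phi a + cap D phi (D - a))^-1)%:E <= muplus mu A)%E.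
Proof.
move=> phiP hd hphi mA AD muA /andP[a0 aD] vE.
have [D0 ch h0 _] := hd.
pose a' := D - a; have [a'0 a'D] : 0 < a' /\ a' < D by rewrite /a'; split; lra.
have a'a : D - a' = a by rewrite /a' subKr.
pose al := cap D phi a; pose be := cap D phi a'.
have al0 : 0 < al by apply: (cap_gt0 phiP); lra.
have be0 : 0 < be by apply: (cap_gt0 phiP); lra.
have abN0 : al + be != 0 by rewrite gt_eqF// addr_gt0.
rewrite -/a' -/al -/be in vE *.
have left b c : 0 < c < D -> 0 <= b <= c ->
    fine (mu `[0, b]%classic) <= cap D phi c * h b.
  move=> /andP[c0 cD] /andP[b0 bc]; rewrite (density_segment hd)//; last lra.
  by apply: left_mass_le => //; lra.
have right b c : 0 < c < D -> c <= b <= D ->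
    fine (mu `[b, D]%classic) <= cap D phi (D - c) * h b.
  move=> /andP[c0 cD] /andP[cb bD]; rewrite (density_segment hd)//; last lra.
  by apply: right_mass_le => //; lra.
have weaken (m M b : R) : m <= M -> m * h b <= M * h b.
  by move=> mM; rewrite ler_wpM2r.
have vE' : v = al / (al + be) by apply: (mulIf abN0); rewrite vE divfK.
have fal : (al + be)^-1 = fine (mu A) / al.
  by rewrite muA vE'; field; rewrite abN0 gt_eqF.
have fbe : (al + be)^-1 = (1 - fine (mu A)) / be.
  by rewrite muA vE'; field; rewrite abN0 gt_eqF.
have [AC|muC] := ltP (fine (mu A)) (fine (mu (closure (A : set R)))).
  exact: muplus_closure.
have {}muC : fine (mu (closure (A : set R))) = fine (mu A).
  apply/eqP; rewrite eq_le muC/= le_fine_probability//.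
    exact: measurable_closure.
  exact: subset_closure.
(* Where both tails are at most M times h, h is at least 1 / (2 M), as the
   tails add up to 1; so two such gap ends contribute at least 1 / M. *)
have two_ends (M p q : R) (I J : set (measurableTypeR R)) :
    0 < M -> M <= al + be ->
    measurable I -> measurable J -> [disjoint I & J] ->
    grows_in mu A I (h p) -> grows_in mu A J (h q) ->
    0 <= p <= D -> 0 <= q <= D ->
    fine (mu `[0, p]%classic) <= M * h p -> fine (mu `[p, D]%classic) <= M * h p ->
    fine (mu `[0, q]%classic) <= M * h q -> fine (mu `[q, D]%classic) <= M * h q ->
    (((al + be)^-1)%:E <= muplus mu A)%E.
  move=> M0 Mab mI mJ IJ gI gJ pD qD lp rp lq rq.
  apply: (@le_trans _ _ (h p + h q)%:E); last first.
    by apply: muplus_ge_growth => //; exact: grows_in_setU gI gJ.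
  rewrite lee_fin -[leLHS]mul1r ler_pdivrMr; last by rewrite addr_gt0.
  have tp := density_total hd pD; have tq := density_total hd qD.
  by have := h0 p; have := h0 q; nra.
have [aa'|a'a'] := leP a a'.
- have albe : al <= be by apply: (cap_le phiP).
  have [Ca|nCa] := pselect (closure (A : set R) a).
    rewrite fbe -muC; apply: (@muplus_contact _ D h mu A a a) => //; try lra.
    + by move=> b ba; apply: le_trans (left b a _ ba) (weaken _ _ _ albe); lra.
    + by move=> b ba; apply: right => //; lra.
    + by move=> x xa; have -> : x = a by lra.
  have [Ca'|nCa'] := pselect (closure (A : set R) a').
    rewrite fbe -muC; apply: (@muplus_contact _ D h mu A a' a') => //; try lra.
    + by move=> b ba; apply: left => //; lra.
    + move=> b ba; apply: le_trans (right b a' _ ba) _; first lra.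
      by rewrite a'a; exact: weaken.
    + by move=> x xa; have -> : x = a' by lra.
  have [[z [Cz az za']]|noz] :=
      pselect (exists z, [/\ closure (A : set R) z, a < z & z < a']).
    have [q [aq qz _ _] gq] := gap_right_end hd nCa Cz (ltW a0) az (ltW (lt_trans za' a'D)).
    have [p [zp pa' _ _] gp] := gap_left_end hd nCa' Cz (ltW (lt_trans a0 az)) za' (ltW a'D).
    apply: (two_ends be q p) gq gp _ _ _ _ _ _ => //; try lra.
    + by apply/disj_set2P; rewrite -subset0 => x [] /=; rewrite !in_itv/=; lra.
    + by apply: left; lra.
    + by apply: right; lra.
    + by apply: left; lra.
    + by apply: right; lra.
  rewrite fal; apply: (@muplus_gap _ D h mu A a a') => //; try lra.
  + by move=> b ba; apply: left => //; lra.
  + by move=> b ba; rewrite /al -a'a; apply: right => //; lra.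
  + move=> x /andP[]; rewrite le_eqVlt => /predU1P[<-//|ax].
    rewrite le_eqVlt => /predU1P[->//|xa'] Cx.
    by apply: noz; exists x.
- have beal : be <= al by apply: (cap_le phiP) => //; exact: ltW.
  have [Ca|nCa] := pselect (closure (A : set R) a); last first.
    rewrite fal; apply: (@muplus_gap _ D h mu A a a) => //; try lra.
    + by move=> b ba; apply: left => //; lra.
    + by move=> b ba; apply: le_trans (right b a _ ba) (weaken _ _ _ beal); lra.
    + by move=> x xa; have -> : x = a by lra.
  have [Ca'|nCa'] := pselect (closure (A : set R) a'); last first.
    rewrite fal; apply: (@muplus_gap _ D h mu A a' a') => //; try lra.
    + by move=> b ba; apply: le_trans (left b a' _ ba) (weaken _ _ _ beal); lra.
    + by move=> b ba; rewrite /al -a'a; apply: right => //; lra.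
    + by move=> x xa; have -> : x = a' by lra.
  have [[u [nCu a'u ua]]|nou] :=
      pselect (exists u, [/\ ~ closure (A : set R) u, a' < u & u < a]).
    have [p [a'p pu _ _] gp] := gap_left_end hd nCu Ca' (ltW a'0) a'u (ltW (lt_trans ua aD)).
    have [q [uq qa _ _] gq] := gap_right_end hd nCu Ca (ltW (lt_trans a'0 a'u)) ua (ltW aD).
    apply: (two_ends al p q) gp gq _ _ _ _ _ _ => //; try lra.
    + by apply/disj_set2P; rewrite -subset0 => x [] /=; rewrite !in_itv/=; lra.
    + by apply: left; lra.
    + by rewrite /al -a'a; apply: right; lra.
    + by apply: left; lra.
    + by rewrite /al -a'a; apply: right; lra.
  rewrite fbe -muC; apply: (@muplus_contact _ D h mu A a' a) => //; try lra.
  + by move=> b ba; apply: left => //; lra.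
  + by move=> b ba; apply: right => //; lra.
  + move=> x /andP[]; rewrite le_eqVlt => /predU1P[<-//|ax].
    rewrite le_eqVlt => /predU1P[->//|xa'].
    by apply: contrapT => nCx; apply: nou; exists x.
Qed.

(** * MCP densities *)

(** Truncation at 0 makes it continuous everywhere; on [0, D] it is the power
    of s_kappa that enters the densities. *)
Definition profile (R : realType) (K N x : R) : R :=
  Num.max 0 (s_kappa (kappa K N) x) `^ (N - 1).

Lemma diameter_bound (R : realType) (K N D : R) : 1 < N ->
  (0 < K -> D <= pi * Num.sqrt ((N - 1) / K)) ->
  0 < kappa K N -> D <= pi / Num.sqrt (kappa K N).
Proof.
move=> N1 hKD k0; have N0 : 0 < N - 1 by lra.
have K0 : 0 < K by move: k0; rewrite /kappa pmulr_lgt0// invr_gt0.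
have := hKD K0; rewrite -[(N - 1) / K]invf_div -/(kappa K N).
by rewrite sqrtrV// ltW.
Qed.

Section MCP.
Context (R : realType) (K N D : R).
Local Notation k := (kappa K N).
Implicit Types (x y t : R) (h : R -> R).

Lemma s_kappa_gt0_in x : 
  (0 < k -> D <= pi / Num.sqrt k) -> 0 < x < D -> 0 < s_kappa k x.
Proof.
move=> hk /andP[x0 xD]; apply: s_kappa_gt0 => // k0.
exact: lt_le_trans xD (hk k0).
Qed.

Lemma s_kappa_ge0_in x :
  (0 < k -> D <= pi / Num.sqrt k) -> 0 <= x <= D -> 0 <= s_kappa k x.
Proof.
move=> hk /andP[]; rewrite le_eqVlt => /predU1P[<- _|x0 xD].
  by rewrite s_kappa0.
have [k0|k0] := ltP 0 k; last first.
  by apply/ltW/s_kappa_gt0 => //; rewrite ltNge k0.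
have := le_trans xD (hk k0); rewrite le_eqVlt => /predU1P[->|xk].
  by rewrite s_kappa_diameter.
exact/ltW/s_kappa_gt0.
Qed.

Lemma profileE x : (0 < k -> D <= pi / Num.sqrt k) -> 0 <= x <= D ->
  profile K N x = s_kappa k x `^ (N - 1).
Proof. by move=> hk xD; rewrite /profile max_r// s_kappa_ge0_in. Qed.

Lemma profile_ge0 x : 0 <= profile K N x.
Proof. exact: powR_ge0. Qed.

Lemma profile_gt0 x : 0 < s_kappa k x -> 0 < profile K N x.
Proof. by move=> sx; rewrite powR_gt0// lt_max sx orbT. Qed.

Lemma profile_eq0 x : 1 < N -> s_kappa k x = 0 -> profile K N x = 0.
Proof. by move=> N1 sx; rewrite /profile sx maxxx powR0// gt_eqF// subr_gt0. Qed.

Lemma powR_ratio x y : (0 < k -> D <= pi / Num.sqrt k) ->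
  0 <= x <= D -> 0 <= y <= D -> 0 < s_kappa k y ->
  (s_kappa k x / s_kappa k y) `^ (N - 1) = profile K N x / profile K N y.
Proof.
move=> hk xD yD sy; have py : profile K N y != 0 by rewrite gt_eqF// profile_gt0.
apply: (mulIf py); rewrite divfK// !profileE// -powRM.
- by rewrite divfK// gt_eqF.
- by rewrite divr_ge0 ?s_kappa_ge0_in// ltW.
- exact: ltW.
Qed.

Lemma profile_ptolemaic : 1 < N -> (0 < k -> D <= pi / Num.sqrt k) ->
  ptolemaic D (profile K N).
Proof.
move=> N1 hk; have N0 : 0 < N - 1 by lra.
have prod_le x y x' y' : 0 <= x <= D -> 0 <= y <= D -> 0 <= x' <= D ->
    0 <= y' <= D ->
    s_kappa k x * s_kappa k y <= s_kappa k x' * s_kappa k y' ->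
    profile K N x * profile K N y <= profile K N x' * profile K N y'.
  move=> xD yD x'D y'D xy.
  have [sx sy sx' sy'] : [/\ 0 <= s_kappa k x, 0 <= s_kappa k y,
    0 <= s_kappa k x' & 0 <= s_kappa k y'] by split; exact: s_kappa_ge0_in.
  rewrite (profileE hk xD) (profileE hk yD) (profileE hk x'D) (profileE hk y'D).
  have E1 := powRM (N - 1) sx sy.
  have E2 := powRM (N - 1) sx' sy'.
  suff : (s_kappa k x * s_kappa k y) `^ (N - 1) <=
      (s_kappa k x' * s_kappa k y') `^ (N - 1) by rewrite E1 E2.
  by apply: ge0_ler_powR => //; rewrite ?nnegrE ?mulr_ge0// ltW.
split.
- move=> x; apply: (@continuous_comp _ _ _ (s_kappa k)
    (fun y => Num.max 0 y `^ (N - 1))); first exact: s_kappa_continuous.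
  exact: continuous_powR_max0.
- by move=> x; exact: profile_ge0.
- by move=> x xD; apply: profile_gt0; exact: s_kappa_gt0_in.
- move=> p q r t pq qr rt tp; apply: prod_le; try lra.
  by rewrite (s_kappa_ptolemy k p q r t) lerDl mulr_ge0// s_kappa_ge0_in//; lra.
- move=> p q r t pq qr rt tp; apply: prod_le; try lra.
  by rewrite (s_kappa_ptolemy k p q r t) lerDr mulr_ge0// s_kappa_ge0_in//; lra.
Qed.

(** Since +oo * 0 = 0 while +oo times a positive number is infinite, an
    infinite sigma forces h y = 0. *)
Lemma MCP_point h y z t : 1 < N -> (0 < k -> D <= pi / Num.sqrt k) ->
  (forall x, 0 <= x <= D -> 0 <= h x) ->
  0 <= y <= D -> 0 <= z <= D -> y != z -> 0 <= t <= 1 ->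
  0 <= h (t * z + (1 - t) * y) ->
  ((sigma K N (1 - t)%R `|z - y|%R) `^ (N - 1)%R * (h y)%:E
          <= (h (t * z + (1 - t) * y)%R)%:E)%E ->
  h y * profile K N ((1 - t) * `|z - y|) <=
  h (t * z + (1 - t) * y) * profile K N `|z - y|.
Proof.
move=> N1 hk hge0 yD zD yz t01 hx.
have N0 : 0 < N - 1 by lra.
have th0 : 0 < `|z - y| by rewrite normr_gt0 subr_eq0 eq_sym.
have thD : `|z - y| <= D by rewrite ler_norml; lra.
rewrite /sigma (gt_eqF th0); case: ifPn => [/andP[k0 kth]|nk].
  rewrite (poweRyr (lt0r_neq0 N0)); have := hge0 _ yD; rewrite le_eqVlt => /predU1P[<- _|hy].
    by rewrite mul0r mulr_ge0// profile_ge0.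
  have e : (+oo * (h y)%:E = +oo)%E by rewrite gt0_mulye ?lte_fin.
  rewrite e leye_eq => /eqP ee.
  discriminate ee.
have sth : 0 < s_kappa k `|z - y|.
  by apply: s_kappa_gt0 => // k0; move: nk; rewrite k0/= -ltNge.
have thD' : 0 <= `|z - y| <= D by rewrite normr_ge0.
have tthD : 0 <= (1 - t) * `|z - y| <= D.
  apply/andP; split; first by rewrite mulr_ge0//; lra.
  by apply: le_trans thD; rewrite ler_piMl//; lra.
rewrite poweR_EFin -EFinM lee_fin (powR_ratio hk tthD thD' sth).
by rewrite mulrC mulrA ler_pdivrMr// profile_gt0.
Qed.

End MCP.

(** The point x is written as a convex combination of x0 and x1, once starting
    from each end. *)
Lemma MCP_contracting (R : realType) (K N D : R) (h : R -> R) :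
  1 < N -> (0 < kappa K N -> D <= pi / Num.sqrt (kappa K N)) ->
  MCP_density K N D h -> contracting D (profile K N) h.
Proof.
move=> N1 hk [hge0 _ _ hM] x0 x x1 x00; rewrite le_eqVlt => /predU1P[<-|x0x].
  move=> x01 x1D; rewrite subrr (profile_eq0 N1 (s_kappa0 _)) mulr0.
  split; first exact: lexx.
  apply: mulr_ge0; last exact: profile_ge0.
  by apply: hge0; rewrite in_itv/= x00 (le_trans x01).
move=> xx1 x1D; have x01 : x0 < x1 by exact: lt_le_trans xx1.
have hge0' y : 0 <= y <= D -> 0 <= h y by move=> yD; apply: hge0; rewrite in_itv.
have d0 : x1 - x0 != 0 by rewrite gt_eqF// subr_gt0.
have nx : `|x1 - x0| = x1 - x0 by rewrite ger0_norm// subr_ge0 ltW.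
pose t := (x - x0) / (x1 - x0).
have t01 : 0 <= t <= 1.
  by rewrite divr_ge0 ?ler_pdivrMr ?subr_gt0//; lra.
have x0D : 0 <= x0 <= D by lra.
have x1D' : 0 <= x1 <= D by lra.
have n01 : x0 != x1 by rewrite lt_eqF.
split.
- have xE : t * x1 + (1 - t) * x0 = x by rewrite /t; field.
  have := @MCP_point _ K N D h x0 x1 t N1 hk hge0' x0D x1D' n01 t01.
  have tE : (1 - t) * `|x1 - x0| = x1 - x by rewrite nx /t; field.
  rewrite tE xE nx -xE; apply; first by rewrite xE; apply: hge0'; lra.
  by rewrite -nx; apply: hM; rewrite in_itv.
- have xE : (1 - t) * x0 + (1 - (1 - t)) * x1 = x by rewrite /t; field.
  have := @MCP_point _ K N D h x1 x0 (1 - t) N1 hk hge0' x1D' x0D _ _.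
  have tE : (1 - (1 - t)) * `|x0 - x1| = x - x0 by rewrite distrC nx /t; field.
  rewrite tE xE distrC nx -xE; apply; rewrite 1?eq_sym//; first lra.
    by rewrite xE; apply: hge0'; lra.
  by rewrite -nx distrC; apply: hM; rewrite in_itv//=; lra.
Qed.

(** If sigma is infinite then x0 and x1 are the two ends of [0, D] and phi (x1
    - x0) = 0.  The contraction inequality at the midpoint then forces h x0 =
    0, and the condition reads 0 <= h x. *)
Lemma contracting_MCP (R : realType) (K N D : R) (h : R -> R) :
  1 < N -> (0 < kappa K N -> D <= pi / Num.sqrt (kappa K N)) ->
  continuous h -> (forall x, 0 <= h x) ->
  contracting D (profile K N) h -> MCP_density K N D h.
Proof.
move=> N1 hk ch hge0 hc; have N0 : 0 < N - 1 by lra.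
split => //.
- by apply: measurable_funTS; exact: continuous_measurable_fun.
- exact: continuous_subspaceT.
move=> x0 x1 t; rewrite !in_itv/= => x0D x1D t01.
set x := t * x1 + (1 - t) * x0.
have [x01|n01] := eqVneq x0 x1.
  have -> : x = x0 by rewrite /x -x01; ring.
  rewrite -x01 subrr normr0 /sigma eqxx poweR_EFin -EFinM lee_fin.
  rewrite ler_piMl//; apply: (@le_trans _ _ (1 `^ (N - 1))); last by rewrite powR1.
  by apply: ge0_ler_powR; rewrite ?nnegrE; lra.
have th0 : 0 < `|x1 - x0| by rewrite normr_gt0 subr_eq0 eq_sym.
have thD : `|x1 - x0| <= D by rewrite ler_norml; lra.
have star s : 0 <= s <= 1 ->
    h x0 * profile K N ((1 - s) * `|x1 - x0|) <=
    h (s * x1 + (1 - s) * x0) * profile K N `|x1 - x0|.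
  move=> s01; have [lt01|lt10] : x0 < x1 \/ x1 < x0.
    by apply/orP; rewrite -neq_lt.
  - have -> : `|x1 - x0| = x1 - x0 by rewrite ger0_norm; lra.
    have -> : (1 - s) * (x1 - x0) = x1 - (s * x1 + (1 - s) * x0) by ring.
    by apply: (hc x0 _ x1 _ _ _ _).1; nra.
  - have -> : `|x1 - x0| = x0 - x1 by rewrite ler0_norm; lra.
    have -> : (1 - s) * (x0 - x1) = (s * x1 + (1 - s) * x0) - x1 by ring.
    by apply: (hc x1 _ x0 _ _ _ _).2; nra.
rewrite /sigma (gt_eqF th0); case: ifPn => [/andP[k0 kth]|nk].
  (* here x0 and x1 are at the maximal distance *)
  have thE : `|x1 - x0| = pi / Num.sqrt (kappa K N).
    by apply/eqP; rewrite eq_le kth andbT (le_trans thD)// hk.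
  have p2 : 0 < profile K N ((1 - 2^-1) * `|x1 - x0|).
    by apply/profile_gt0/(@s_kappa_gt0_in _ K N D) => //; lra.
  have := star 2^-1; rewrite [X in _ -> _ <= _ * X]profile_eq0//; last first.
    by rewrite thE s_kappa_diameter.
  rewrite mulr0 pmulr_lle0// => h00.
  have -> : h x0 = 0 by apply/eqP; rewrite eq_le hge0 h00//; lra.
  by rewrite mule0 lee_fin hge0.
have sth : 0 < s_kappa (kappa K N) `|x1 - x0|.
  by apply: s_kappa_gt0 => // k0; move: nk; rewrite k0/= -ltNge.
have thD' : 0 <= `|x1 - x0| <= D by rewrite normr_ge0.
have tthD : 0 <= (1 - t) * `|x1 - x0| <= D.
  apply/andP; split; first by rewrite mulr_ge0//; lra.
  by apply: le_trans thD; rewrite ler_piMl//; lra.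
rewrite poweR_EFin -EFinM lee_fin (powR_ratio hk tthD thD' sth).
rewrite mulrC mulrA ler_pdivrMr; last exact: profile_gt0.
exact: star.
Qed.

Lemma eq_contracting (R : realType) (D : R) (phi h g : R -> R) :
  (forall x, 0 <= x <= D -> h x = g x) -> contracting D phi h ->
  contracting D phi g.
Proof.
move=> hg hc x0 x x1 h0 h1 h2 h3; rewrite -!hg; [exact: hc|lra..].
Qed.

(** Projecting onto [0, D] first turns a function continuous on [0, D] into one
    continuous on the line. *)
Lemma clamp_continuous (R : realType) (D : R) (h : R -> R) : 0 < D ->
  {within `[0, D], continuous h} ->
  continuous (fun x => h (Num.max 0 (Num.min x D))).
Proof.
move=> D0 /subspace_continuousP ch x.
pose c (x : R) : R := Num.max 0 (Num.min x D).
have cD y : `[0, D]%classic (c y).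
  by rewrite /= in_itv/= le_max lexx ge_max (ltW D0) ge_min lexx orbT.
have cc : continuous c.
  move=> y; apply: (@continuous_max _ _ (fun=> 0) (fun x => Num.min x D)).
    exact: cst_continuous.
  apply: (@continuous_min _ _ id (fun=> D)); first exact: cvg_id.
  exact: cst_continuous.
have := ch _ (cD x).
move=> hc; apply: (@cvg_comp _ _ _ c h _ (within `[0, D] (nbhs (c x)))) hc.
move=> V /= [e /= e0 he].
have /cvgrPdist_lt /(_ _ e0) := cc x.
by apply: filterS => y xy; exact: (he (c y) xy (cD y)).
Qed.

Lemma MCP_has_density (R : realType) (K N D : R) (h : R -> R)
    (mu : probability (measurableTypeR R) R) : 0 < D -> MCP_density K N D h ->
  (forall B : set (measurableTypeR R), measurable B ->
       mu B = (\int[lebesgue_measure]_(x in B `&` `[0%R, D]) (h x)%:E)%E) ->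
  has_density D (fun x => h (Num.max 0 (Num.min x D))) mu.
Proof.
move=> D0 [h0 _ ch _] muE; split => //.
- exact: clamp_continuous.
- by move=> x; apply: h0; rewrite in_itv/= le_max lexx ge_max (ltW D0) ge_min lexx orbT.
- move=> B mB; rewrite muE//; apply: eq_integral => x.
  rewrite inE => -[_ /=]; rewrite in_itv/= => /andP[x0 xD].
  by rewrite min_l// max_r.
Qed.

Section probability_of_density.
Context (R : realType) (D : R) (h : R -> R).
Hypotheses (D_gt0 : 0 < D) (ch : continuous h) (h0 : forall x, 0 <= h x).
Hypothesis h1 : \int[leb]_(x in `[0, D]) h x = 1.

Definition density_measure (B : set (measurableTypeR R)) : \bar R :=
  (\int[leb]_(x in B `&` `[0%R, D]) (h x)%:E)%E.

Let density_measure0 : density_measure set0 = 0%E.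
Proof. by rewrite /density_measure set0I integral_set0. Qed.

Let density_measure_ge0 B : (0 <= density_measure B)%E.
Proof. by apply: integral_ge0 => x _; rewrite lee_fin. Qed.

Let density_measure_sigma_additive : semi_sigma_additive density_measure.
Proof.
move=> F mF tF mUF; rewrite /density_measure; apply: cvg_toP.
  apply: ereal_nondecreasing_is_cvgn => m n mn.
  by apply: lee_sum_nneg_natr => // n' _ _; exact: density_measure_ge0.
rewrite setI_bigcupl ge0_integral_bigcup//=.
- by move=> i; exact: measurableI.
- apply: measurable_funTS; apply/measurable_EFinP.
  exact: continuous_measurable_fun.
- by move=> x _; rewrite lee_fin.
- exact: trivIset_setIr.
Qed.

HB.instance Definition _ := isMeasure.Build _ _ _ density_measure
  density_measure0 density_measure_ge0 density_measure_sigma_additive.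

Let density_measure_setT : density_measure setT = 1%:E.
Proof.
rewrite /density_measure setTI -h1 fineK//.
apply: integrable_fin_num => //; exact: continuous_integrable_segment.
Qed.

HB.instance Definition _ := @Measure_isProbability.Build _ _ R
  density_measure density_measure_setT.

Lemma density_measure_has_density :
  exists mu : probability (measurableTypeR R) R, has_density D h mu.
Proof. by exists density_measure; split. Qed.

End probability_of_density.

(** The enlargement of [0, a] of radius eps only adds ]a, a + eps[ within [0,
    D]. *)
Lemma muplus_initial_segment (R : realType) (D : R) (h : R -> R)
    (mu : probability (measurableTypeR R) R) (a : R) :
  has_density D h mu -> 0 <= a < D ->
  (muplus mu `[0%R, a]%classic <= (h a)%:E)%E.
Proof.
move=> hd /andP[a0 aD]; have [D0 ch h0 _] := hd.
apply/lee_addgt0Pr => rho rho0; rewrite -EFinD.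
have /cvgrPdist_lt /(_ _ rho0) [d /= d0 hd'] := ch a.
apply: (@muplus_le _ _ _ _ (Num.min d (D - a))) => //.
  by rewrite lt_min d0 subr_gt0.
move=> e; rewrite lt_min => /and3P[e0 ed ea].
rewrite lerBlDl (density_carrier hd); last exact: measurable_enlargement.
have -> : (h a + rho) * e = (h a + rho) * (a + e - a) by ring.
apply: (@le_trans _ _ (fine (mu `[0, a]%classic) + fine (mu `[a, a + e]%classic))).
  apply: fine_probability_subadd => //.
    by apply: measurableI => //; exact: measurable_enlargement.
  move=> x [/enlargementP[y /=]]; rewrite !in_itv/= => /andP[y0 ya] xy /andP[x0 xD].
  have xae : x <= a + e by move: xy; rewrite ltr_distl; lra.
  have [xa|ax] := leP x a; [left|right]; lra.
rewrite lerD2l (density_segment hd)//; last lra.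
apply: integral_segment_le => //; first lra.
move=> x /andP[ax xe]; have [->|xa] := eqVneq x a; first lra.
have /hd' : `|a - x| < d by rewrite ler0_norm; lra.
by rewrite ltr_distlC => /andP[? ?]; lra.
Qed.

(** * The extremal density *)

(** The formula by cases defining h_a, up to its normalisation, is the maximum
    [peak]. *)
Lemma powR_ratio_peak (R : realType) (K N D a x : R) :
  1 < N -> (0 < kappa K N -> D <= pi / Num.sqrt (kappa K N)) ->
  0 < a < D -> 0 <= x <= D ->
  let s := s_kappa (kappa K N) in
  (if x <= a then (s (D - x) / s (D - a)) `^ (N - 1)
   else (s x / s a) `^ (N - 1)) = peak D (profile K N) a x.
Proof.
move=> N1 hk aD xD s; have phiP := profile_ptolemaic N1 hk.
have sa : 0 < s a by exact: (s_kappa_gt0_in hk aD).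
have sDa : 0 < s (D - a) by apply: (s_kappa_gt0_in hk); lra.
have [xa|ax] := leP x a.
  rewrite (peak_left phiP aD); last by lra.
  by rewrite (powR_ratio hk _ _ sDa)//; lra.
rewrite (peak_right phiP aD); last by lra.
by rewrite (powR_ratio hk _ _ sa)//; lra.
Qed.

Lemma fKND_cap (R : realType) (K N D a : R) :
  1 < N -> (0 < kappa K N -> D <= pi / Num.sqrt (kappa K N)) -> 0 < a < D ->
  fKND K N D a =
  (cap D (profile K N) a + cap D (profile K N) (D - a))^-1.
Proof.
move=> N1 hk aD; have phiP := profile_ptolemaic N1 hk.
rewrite -(peak_left_mass phiP aD) -(peak_right_mass phiP aD).
rewrite /fKND; congr (_ + _)^-1; apply: eq_Rintegral => x.
  rewrite inE/= in_itv/= => /andP[x0 xa].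
  by rewrite -(powR_ratio_peak N1 hk aD) ?xa//; lra.
rewrite inE/= in_itv/= le_eqVlt => /andP[/predU1P[<-|ax] xD].
  rewrite (peak_at phiP aD) divff ?powR1// gt_eqF//.
  exact: (s_kappa_gt0_in hk aD).
by rewrite -(powR_ratio_peak N1 hk aD) ?leNgt ?ax//; lra.
Qed.

Lemma hKND_peak (R : realType) (K N D a x : R) :
  1 < N -> (0 < kappa K N -> D <= pi / Num.sqrt (kappa K N)) ->
  0 < a < D -> 0 <= x <= D ->
  hKND K N D a x = fKND K N D a * peak D (profile K N) a x.
Proof.
move=> N1 hk aD xD; rewrite -(powR_ratio_peak N1 hk aD xD) /hKND.
by case: ifP.
Qed.

Lemma integral_hKND (R : realType) (K N D a : R) :
  1 < N -> (0 < kappa K N -> D <= pi / Num.sqrt (kappa K N)) -> 0 < a < D ->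
  \int[leb]_(x in `[0, a]) hKND K N D a x =
  fKND K N D a * cap D (profile K N) a.
Proof.
move=> N1 hk aD; have phiP := profile_ptolemaic N1 hk.
rewrite -(peak_left_mass phiP aD) -integral_segmentZ; last first.
  exact: (peak_continuous phiP).
apply: eq_Rintegral => x; rewrite inE/= in_itv/= => xa.
by rewrite hKND_peak//; lra.
Qed.

(** Given the factor fKND = 1 / (cap a + cap (D - a)), the equation defining
    a(v) is the balance of [cap_balance], which provides a solution. *)
Lemma aKND_spec (R : realType) (K N D v : R) :
  1 < N -> 0 < D -> (0 < kappa K N -> D <= pi / Num.sqrt (kappa K N)) ->
  0 < v < 1 ->
  let a := aKND K N D v in
  0 < a < D /\ v * (cap D (profile K N) a + cap D (profile K N) (D - a)) =
               cap D (profile K N) a.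
Proof.
move=> N1 D0 hk v01; have phiP := profile_ptolemaic N1 hk.
have cap_pos b : 0 < b < D ->
    cap D (profile K N) b + cap D (profile K N) (D - b) != 0.
  by move=> bD; rewrite gt_eqF// addr_gt0// (cap_gt0 phiP)//; lra.
rewrite /aKND; case: xgetP => [a _ [aD intv]|no].
  split => //; move: intv; rewrite integral_hKND// fKND_cap// => <-.
  by rewrite mulrC mulrA divff ?mul1r// cap_pos.
have [a aD av] := cap_balance D0 phiP v01.
suff intv : \int[leb]_(x in `[0, a]) hKND K N D a x = v.
  by case: (no a (conj aD intv)).
clear no; rewrite (integral_hKND N1 hk aD) (fKND_cap N1 hk aD).
move: (cap_pos a aD) av.
move: (cap D _ a) (cap D _ (D - a)) => u w uw av.
by apply: (mulfI uw); rewrite mulrA divff// mul1r mulrDl [w * v]mulrC -av; ring.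
Qed.

Theorem theorem3p7 (R : realType) (K N D : R) (hN : 1 < N) (hD : 0 < D)
    (hKD : 0 < K -> D <= pi * Num.sqrt ((N - 1) / K))
    (v : R) (hv : 0 < v < 1) :
  let a := aKND K N D v in
  [/\ Itilde K N D v = (fKND K N D a)%:E,
      fKND K N D a = hKND K N D a a &
      exists (mu : probability (measurableTypeR R) R)
             (A : set (measurableTypeR R)),
        competitor K N D v mu A /\ muplus mu A = Itilde K N D v].
Proof.
have hk := diameter_bound hN hKD; have phiP := profile_ptolemaic hN hk.
have [] := aKND_spec hN hD hk hv; move: (aKND K N D v) => a aD.
have aD' : 0 < D - a < D by lra.
have haa : hKND K N D a a = fKND K N D a.
  rewrite (hKND_peak hN hk aD) ?(peak_at phiP aD) ?mulr1//.
  by case/andP: aD => a0 a1; rewrite !ltW.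
move=> av /=; rewrite haa; move: (fKND_cap hN hk aD).
move: (fKND K N D a) => {haa} f fE.
have [a0 a1] := andP aD.
have capa := cap_gt0 phiP aD; have capDa := cap_gt0 phiP aD'.
have cap0 := addr_gt0 capa capDa.
have f0 : 0 < f by rewrite fE invr_gt0.
have fcapa : f * cap D (profile K N) a = v.
  by rewrite fE -[X in _ * X]av mulrCA mulVf ?mulr1// lt0r_neq0.
have fcapDa : f * cap D (profile K N) (D - a) = 1 - v.
  apply/eqP; rewrite eq_sym subr_eq -fcapa -mulrDr addrC fE mulVf//.
  exact: lt0r_neq0.
have lower mu A : competitor K N D v mu A -> (f%:E <= muplus mu A)%E.
  move=> [[h hMCP muE] mA AD muA]; rewrite fE.
  apply: (muplus_ge_cap phiP (MCP_has_density hD hMCP muE) _ mA AD _ aD av).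
    apply: eq_contracting (MCP_contracting hN hk hMCP) => x /andP[x0 xD].
    by rewrite min_l// max_r.
  by rewrite muA.
pose h x := f * peak D (profile K N) a x.
have ch : continuous h.
  by move=> x; apply: cvgMl_tmp; exact: (peak_continuous phiP).
have h0 x : 0 <= h x by rewrite mulr_ge0 ?(ltW f0)// (peak_ge0 _ _ phiP).
have ha : h a = f by rewrite /h (peak_at phiP aD) mulr1.
have hpeak : contracting D (profile K N) h.
  move=> x0 x x1 h1 h2 h3 h4.
  have [l r] := peak_contracting phiP aD h1 h2 h3 h4.
  split; rewrite /h -[leLHS]mulrA -[leRHS]mulrA (ler_pM2l f0).
    exact: l.
  exact: r.
have hleft : \int[leb]_(x in `[0, a]) h x = v.
  rewrite integral_segmentZ; last exact: (peak_continuous phiP).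
  by rewrite (peak_left_mass phiP aD).
have hright : \int[leb]_(x in `[a, D]) h x = 1 - v.
  rewrite integral_segmentZ; last exact: (peak_continuous phiP).
  by rewrite (peak_right_mass phiP aD).
have hint : \int[leb]_(x in `[0, D]) h x = 1.
  rewrite (@integral_segment_cat _ _ 0 a D)//; [|exact: ltW..].
  by rewrite hleft hright addrC subrK.
have [mu hd] := density_measure_has_density hD ch h0 hint.
pose A : set (measurableTypeR R) := `[0, a]%classic.
have mA : measurable A by exact: measurable_itv.
have comp : competitor K N D v mu A.
  split => //.
  - exists h; first exact: contracting_MCP.
    exact: densityE hd.
  - by apply: subset_itvl; rewrite bnd_simp; exact: ltW.
  - rewrite -(fine_probability mu mA) /A.
    rewrite (density_segment hd (lexx 0) (ltW a1)).
    by rewrite hleft.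
have muA : muplus mu A = f%:E.
  apply/eqP; rewrite eq_le lower// andbT -ha.
  by apply: muplus_initial_segment hd _; rewrite ltW.
have I : Itilde K N D v = f%:E.
  apply/eqP; rewrite eq_le; apply/andP; split.
    by apply: ereal_inf_lbound; exists mu, A.
  by apply: le_ereal_inf_tmp => _ [nu [B [hB ->]]]; exact: lower.
split => //; by exists mu, A; rewrite muA I.
Qed.
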